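(* Let $K\ge 1$ and $p\in(0,2]$. Let $\{\psi_n(r)\}_{n\ge 0}\in\mathcal{F}$ be such that $\{\psi_n(r)\}_{n=1}^\infty$ is a decreasing sequence. Suppose that $$\Phi_4(r):=\frac{2K}{K+1}\sum_{n=1}^\infty \psi_n(r)-\frac{p}{2}\psi_0(r)\le 0\quad\text{for } r\le R_{K},$$ where $R_{K}$ is the minimal positive root of the equation $\Phi_4(r)=0$. If $f(z)=h(z)+\overline{g(z)}=\sum_{n=0}^\infty a_nz^n+\overline{\sum_{n=1}^\infty b_nz^n}$ is a sense-preserving $K$-quasiconformal harmonic mapping in $\mathbb{D}$, where $h$ is bounded in $\mathbb{D}$, then $$|a_0|^p\psi_0(r)+\sum_{n=1}^\infty (|a_n|+|b_n|)\psi_n(r)+\sum_{n=1}^\infty|a_n|^2\left(\frac{\psi_{2n}(r)}{1+|a_0|}+\Psi_{2n+1}(r)\right)\le \psi_0(r)\,\|h\|_\infty\quad\text{for } r\le R_{K}.$$ Moreover, if $\Phi_4(r)>0$ in some interval $(R_{K},R_{K}+\epsilon)$ with $\epsilon>0$, then the number $R_{K}$ cannot be improved.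
   Context: $\mathbb{D}=\{z\in\mathbb{C}:|z|<1\}$, $\|h\|_\infty=\sup_{z\in\mathbb{D}}|h(z)|$, and $\Psi_t(r)=\sum_{k=t}^\infty\psi_k(r)$. $\mathcal{F}$ is the set of all sequences $\{\psi_n(r)\}_{n=0}^\infty$ of non-negative continuous functions on $[0,1)$ such that $\sum_{n=0}^\infty\psi_n(r)$ converges locally uniformly on $[0,1)$. ''Decreasing'' means $\psi_{n+1}(r)\le\psi_n(r)$ for all $n\ge1$ and all $r\in[0,1)$. A harmonic mapping $f=h+\overline{g}$ ($h,g$ analytic in $\mathbb{D}$) is locally univalent and sense-preserving iff $|h'|^2-|g'|^2>0$ in $\mathbb{D}$; such an $f$ is called $K$-quasiconformal ($K\ge1$) if $|g'(z)/h'(z)|\le k$ for all $z\in\mathbb{D}$, where $k=(K-1)/(K+1)\in[0,1)$. ''The number $R_K$ cannot be improved'' means: for no $R'>R_K$ does the inequality hold for all such $f$ and all $r\le R'$. The variable $r$ ranges over $[0,1)$.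
   Formalization: The formal theorem adds the normalization ‖h‖_∞ = 1, both for the inequality and for sharpness; for merely bounded h the printed inequality fails, e.g. ψ_n(r)=r^n, K=1, p=2, g=0, h(z)=2+z/10 at r=0 gives 4 ≤ 2.1. *)

(* Defs.v *)
From Stdlib Require Import Reals.
From Coquelicot Require Import Coquelicot.

Open Scope R_scope.

Definition unit_disk (z : C) : Prop := Cmod z < 1.

(* Real power x^p for x >= 0 and p > 0.  [Rpower 0 p] equals 1 because
   [ln 0 = 0], hence the separate case. *)
Definition rpow (x p : R) : R :=
  if Req_EM_T x 0 then 0 else Rpower x p.

(** * The class F of sequences of weights *)

Definition unit_Ico (r : R) : Prop := 0 <= r < 1.

(* [CVU_dom u D] is uniform convergence of [u] on [D] to a finite pointwise
   limit; continuity on [0,1) is relative to [0,1), so one-sided at 0. *)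
Definition class_F (psi : nat -> R -> R) : Prop :=
  (forall n r, unit_Ico r -> 0 <= psi n r) /\
  (forall n, continuous_on unit_Ico (psi n)) /\
  (forall r0, unit_Ico r0 -> exists delta, 0 < delta /\
     CVU_dom (fun N r => sum_n (fun k => psi k r) N)
             (fun r => unit_Ico r /\ Rabs (r - r0) < delta)).

Definition decreasing_from_1 (psi : nat -> R -> R) : Prop :=
  forall n r, (1 <= n)%nat -> unit_Ico r -> psi (S n) r <= psi n r.

Definition Psi (psi : nat -> R -> R) (t : nat) (r : R) : R :=
  Series (fun k => psi (t + k)%nat r).

Definition Phi4 (K p : R) (psi : nat -> R -> R) (r : R) : R :=
  2 * K / (K + 1) * Psi psi 1 r - p / 2 * psi 0%nat r.

Definition minimal_positive_root (Phi : R -> R) (R0 : R) : Prop :=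
  0 < R0 < 1 /\ Phi R0 = 0 /\
  (forall r, 0 < r < 1 -> Phi r = 0 -> R0 <= r).

(** * Harmonic mappings of the unit disk *)

Definition analytic_on_disk (h : C -> C) : Prop :=
  forall z : C, unit_disk z -> @ex_derive C_AbsRing C_NormedModule h z.

Definition taylor_on_disk (a : nat -> C) (h : C -> C) : Prop :=
  forall z : C, unit_disk z -> @is_pseries C_AbsRing C_NormedModule a z (h z).

(* f = h + conj g with h(z) = sum_{n>=0} a_n z^n, g(z) = sum_{n>=1} b_n z^n;
   the coefficient b_0 is set to 0 so that both series start at 0. *)
Definition harmonic_mapping
    (f h g : C -> C) (a b : nat -> C) : Prop :=
  analytic_on_disk h /\ analytic_on_disk g /\
  taylor_on_disk a h /\ taylor_on_disk b g /\ b 0%nat = RtoC 0 /\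
  (forall z, unit_disk z -> f z = (h z + Cconj (g z))%C).

(* Positivity of the Jacobian of h + conj g; by Lewy's theorem this is local
   univalence together with preservation of orientation. *)
Definition sense_preserving (h g : C -> C) : Prop :=
  forall z, unit_disk z ->
    0 < Cmod (C_derive h z) ^ 2 - Cmod (C_derive g z) ^ 2.

Definition quasiconformal (K : R) (h g : C -> C) : Prop :=
  forall z, unit_disk z ->
    Cmod (C_derive g z / C_derive h z)%C <= (K - 1) / (K + 1).

Definition sp_qc_harmonic_mapping
    (K : R) (f h g : C -> C) (a b : nat -> C) : Prop :=
  harmonic_mapping f h g a b /\ sense_preserving h g /\ quasiconformal K h g.

Definition bounded_on_disk (h : C -> C) : Prop :=
  exists M : R, forall z, unit_disk z -> Cmod (h z) <= M.

(* Only meaningful for h bounded on the disk, since [real] sends an infinite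
   supremum to 0. *)
Definition sup_norm (h : C -> C) : R :=
  real (Lub_Rbar (fun x => exists z, unit_disk z /\ x = Cmod (h z))).

(** * The inequality *)

Definition linear_term
    (psi : nat -> R -> R) (a b : nat -> C) (r : R) (n : nat) : R :=
  (Cmod (a n) + Cmod (b n)) * psi n r.

Definition quadratic_term
    (psi : nat -> R -> R) (a : nat -> C) (r : R) (n : nat) : R :=
  Cmod (a n) ^ 2 *
    (psi (2 * n)%nat r / (1 + Cmod (a 0%nat)) + Psi psi (2 * n + 1) r).

(* The terms are non-negative, so the inequality fails if one of the two
   series diverges; convergence is explicit because [Series] is total. *)
Definition bohr_inequality
    (p : R) (psi : nat -> R -> R) (h : C -> C) (a b : nat -> C) (r : R)
    : Prop :=
  ex_series (fun n => linear_term psi a b r (S n)) /\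
  ex_series (fun n => quadratic_term psi a r (S n)) /\
  rpow (Cmod (a 0%nat)) p * psi 0%nat r
    + Series (fun n => linear_term psi a b r (S n))
    + Series (fun n => quadratic_term psi a r (S n))
  <= psi 0%nat r * sup_norm h.

(* The inequality up to radius R0 for all mappings in the class, with the
   normalization sup |h| = 1: without it the inequality is not invariant under
   scaling and fails (for p = 2, h close to the constant 2; for p < 1, h close
   to a constant in (0,1)). *)
Definition bohr_inequality_upto
    (K p : R) (psi : nat -> R -> R) (R0 : R) : Prop :=
  forall (f h g : C -> C) (a b : nat -> C),
    sp_qc_harmonic_mapping K f h g a b ->
    bounded_on_disk h ->
    sup_norm h = 1 ->
    forall r, unit_Ico r -> r <= R0 -> bohr_inequality p psi h a b r.

(* Main.v *)
Require Import Defs.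
From Stdlib Require Import Reals Lra Lia Psatz Arith ClassicalEpsilon.
From Coquelicot Require Import Coquelicot.
Open Scope R_scope.

(* On coefficients everything reduces to one l2 estimate: if a power series [a] is
   bounded by M on the disk, then q |-> a * q (Cauchy product) cut off at degree N
   has l2 norm at most M, by Parseval over the roots of unity, with no Cauchy integral.

   Testing |[z^N] h q^2| <= ||q||^2 on suitable polynomials q gives Carlson's bounds
     |a_{2n+1}| <= 1 - sum_{j<=n} |a_j|^2,
     |a_{2n}| <= 1 - sum_{j<n} |a_j|^2 - |a_n|^2 / (1 + |a_0|),
   which, multiplied by psi_m and summed over m, bound the a-part and the quadratic part
   together by (1 - |a_0|^2) Psi_1.  For the b-part, g' = omega h' with |omega| <= k
   gives sum_{n<=N} n^2 |b_n|^2 <= k^2 sum_{n<=N} n^2 |a_n|^2 for every N; summation by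
   parts against the decreasing weights psi_n / n^2 and Cauchy-Schwarz give
   sum |b_n| psi_n <= k (1 - |a_0|^2) Psi_1.  Since 1 + k = 2K/(K+1), the condition
   Phi_4 <= 0 and |a_0|^p + (p/2) (1 - |a_0|^2) <= 1 conclude.

   The radius is sharp for h = (x - z) / (1 - x z), g = k (h - x) as x -> 1. *)

(** * Finite complex sums and Cauchy products *)

(** Sampling at D + 1 roots of unity is exact for polynomials of degree D, and the tails of a series
    are uniform on each circle inside the disk; this is what stands in for integrals over circles.

    The obstacle is the dilatation. It is given as a pointwise quotient g'/h', while the l2 estimate
    needs a factor that is a power series. The formal reciprocal of h' always exists but has no a
    priori radius of convergence. It is carried from radius 0 to any rho < 1 in finitely many equal
    steps, each controlled by the l2 estimate itself: being cut off at degree N, that estimate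
    accepts an arbitrary formal series as q.

    The form of Phi_4 shows in the extremal example. For |a_0| = x near 1, the linear part is about
    (1 + k) (1 - x^2) Psi_1 and the room left by |a_0|^p is (1 - x^p) psi_0, about p (1 - x) psi_0.
    Their difference divided by 2 (1 - x) tends to (1 + k) Psi_1 - (p/2) psi_0, which is Phi_4;
    hence its sign decides on both sides of the radius. *)

Fixpoint csum (f : nat -> C) (n : nat) : C :=
  match n with
  | O => f 0%nat
  | S k => (csum f k + f (S k))%C
  end.

Lemma csum_sum_n (f : nat -> C) n : csum f n = @sum_n C_AbelianGroup f n.
Proof.
  induction n as [|n IH]; simpl.
  - now rewrite sum_O.
  - now rewrite sum_Sn, <- IH.
Qed.

Lemma csum_ext (f g : nat -> C) n :
  (forall i, (i <= n)%nat -> f i = g i) -> csum f n = csum g n.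
Proof.
  induction n as [|n IH]; intros H; simpl.
  - apply H; lia.
  - rewrite IH, (H (S n)) by auto. reflexivity.
Qed.

Lemma csum_plus (f g : nat -> C) n :
  csum (fun i => f i + g i)%C n = (csum f n + csum g n)%C.
Proof. induction n as [|n IH]; simpl; [reflexivity|rewrite IH; ring]. Qed.

Lemma csum_mult_l (c : C) (f : nat -> C) n :
  csum (fun i => c * f i)%C n = (c * csum f n)%C.
Proof. induction n as [|n IH]; simpl; [reflexivity|rewrite IH; ring]. Qed.

Lemma csum_mult_r (c : C) (f : nat -> C) n :
  csum (fun i => f i * c)%C n = (csum f n * c)%C.
Proof. induction n as [|n IH]; simpl; [reflexivity|rewrite IH; ring]. Qed.

Lemma csum_zero (f : nat -> C) n :
  (forall i, (i <= n)%nat -> f i = 0%C) -> csum f n = 0%C.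
Proof.
  intros H. rewrite (csum_ext _ (fun _ => 0 * 0)%C).
  - rewrite csum_mult_l; ring.
  - intros i Hi; rewrite H by easy; ring.
Qed.

Lemma csum_minus (f g : nat -> C) n :
  csum (fun i => f i - g i)%C n = (csum f n - csum g n)%C.
Proof. induction n as [|n IH]; simpl; [reflexivity|rewrite IH; ring]. Qed.

Lemma csum_switch (f : nat -> nat -> C) m n :
  csum (fun i => csum (f i) m) n = csum (fun j => csum (fun i => f i j) n) m.
Proof.
  induction n as [|n IH]; simpl; [reflexivity|].
  now rewrite IH, <- csum_plus.
Qed.

(** Both sides run over the triangle i + j <= n. Associativity of [conv] and the remainder of a
    Cauchy product are instances. *)
Lemma csum_diagonals (f : nat -> nat -> C) n :
  csum (fun m => csum (fun i => f i (m - i)%nat) m) n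
  = csum (fun i => csum (f i) (n - i)) n.
Proof.
  induction n as [|n IH]; [reflexivity|].
  change (csum (fun m => csum (fun i => f i (m - i)%nat) m) n
          + (csum (fun i => f i (S n - i)%nat) n + f (S n) (S n - S n)%nat)
          = csum (fun i => csum (f i) (S n - i)) n
            + csum (f (S n)) (S n - S n))%C.
  rewrite IH, Nat.sub_diag, Cplus_assoc, <- csum_plus. f_equal.
  apply csum_ext; intros i Hi. now replace (S n - i)%nat with (S (n - i)) by lia.
Qed.

Lemma csum_shift (f : nat -> C) n :
  csum f (S n) = (f 0%nat + csum (fun i => f (S i)) n)%C.
Proof. induction n as [|n IH]; [reflexivity|]. simpl in *; rewrite IH; ring. Qed.

Lemma csum_rev (f : nat -> C) n : csum (fun i => f (n - i)%nat) n = csum f n.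
Proof.
  induction n as [|n IH]; [reflexivity|].
  rewrite csum_shift. simpl (csum f (S n)). rewrite <- IH, Nat.sub_0_r. ring_simplify.
  reflexivity.
Qed.

Lemma csum_RtoC (f : nat -> R) n :
  csum (fun i => RtoC (f i)) n = RtoC (sum_f_R0 f n).
Proof. induction n as [|n IH]; simpl; [reflexivity|now rewrite IH, RtoC_plus]. Qed.

Lemma csum_conj (f : nat -> C) n : Cconj (csum f n) = csum (fun i => Cconj (f i)) n.
Proof. induction n as [|n IH]; simpl; [reflexivity|now rewrite Cplus_conj, IH]. Qed.

Lemma Cmod_csum_le (f : nat -> C) n :
  Cmod (csum f n) <= sum_f_R0 (fun i => Cmod (f i)) n.
Proof.
  induction n as [|n IH]; simpl; [lra|].
  eapply Rle_trans; [apply Cmod_triangle|lra].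
Qed.

Lemma Cmod_csum_diff_le (f : nat -> C) m n : (m <= n)%nat ->
  Cmod (csum f n - csum f m)
  <= sum_f_R0 (fun i => Cmod (f i)) n - sum_f_R0 (fun i => Cmod (f i)) m.
Proof.
  induction 1 as [|n Hmn IH].
  - replace (csum f m - csum f m)%C with (RtoC 0) by ring. rewrite Cmod_0; lra.
  - simpl. replace (csum f n + f (S n) - csum f m)%C
      with ((csum f n - csum f m) + f (S n))%C by ring.
    eapply Rle_trans; [apply Cmod_triangle|lra].
Qed.

Definition conv (a b : nat -> C) (n : nat) : C :=
  csum (fun i => a i * b (n - i)%nat)%C n.

Lemma conv_ext (a a' b b' : nat -> C) n :
  (forall i, (i <= n)%nat -> a i = a' i) -> (forall i, (i <= n)%nat -> b i = b' i) ->
  conv a b n = conv a' b' n.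
Proof.
  intros Ha Hb; apply csum_ext; intros i Hi.
  rewrite Ha, Hb by lia; reflexivity.
Qed.

Lemma conv_comm (a b : nat -> C) n : conv a b n = conv b a n.
Proof.
  unfold conv. rewrite <- csum_rev. apply csum_ext; intros i Hi.
  replace (n - (n - i))%nat with i by lia. ring.
Qed.

Lemma conv_assoc (a b c : nat -> C) n :
  conv (conv a b) c n = conv a (conv b c) n.
Proof.
  transitivity (csum (fun m => csum (fun i => a i * b (m - i)%nat * c (n - i - (m - i))%nat)%C m) n).
  - apply csum_ext; intros m Hm. unfold conv. rewrite <- csum_mult_r.
    apply csum_ext; intros i Hi. now replace (n - i - (m - i))%nat with (n - m)%nat by lia.
  - rewrite (csum_diagonals (fun i j => a i * b j * c (n - i - j)%nat)%C).
    apply csum_ext; intros i Hi. unfold conv. rewrite <- csum_mult_l.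
    apply csum_ext; intros j Hj; ring.
Qed.

(** The unit of [conv]: the coefficients of the constant function 1. *)
Definition cone (n : nat) : C := match n with O => 1%C | _ => 0%C end.

Lemma conv_cone_l (a : nat -> C) n : conv cone a n = a n.
Proof.
  unfold conv. destruct n as [|n]; [simpl; ring|].
  rewrite csum_shift, csum_zero by (intros; simpl; ring).
  simpl cone; rewrite Nat.sub_0_r; ring.
Qed.

Lemma conv_scale (a b : nat -> C) (t : C) n :
  conv (fun k => a k * t ^ k)%C (fun k => b k * t ^ k)%C n = (conv a b n * t ^ n)%C.
Proof.
  unfold conv. rewrite <- csum_mult_r. apply csum_ext; intros i Hi.
  replace (t ^ n)%C with (t ^ i * t ^ (n - i))%C; [ring|].
  rewrite <- Cpow_add_r. f_equal; lia.
Qed.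

Lemma sum_f_R0_diagonals (f : nat -> nat -> R) n :
  sum_f_R0 (fun m => sum_f_R0 (fun i => f i (m - i)%nat) m) n
  = sum_f_R0 (fun i => sum_f_R0 (f i) (n - i)) n.
Proof.
  apply RtoC_inj. rewrite <- !csum_RtoC.
  rewrite (csum_ext _ (fun m => csum (fun i => RtoC (f i (m - i)%nat)) m))
    by (intros; now rewrite csum_RtoC).
  rewrite (csum_diagonals (fun i j => RtoC (f i j))).
  apply csum_ext; intros; apply csum_RtoC.
Qed.

(** * Convergence of complex power series in the unit disk *)

Definition disk_conv (a : nat -> C) : Prop :=
  forall rho, 0 <= rho < 1 -> ex_series (fun n => Cmod (a n) * rho ^ n).

(** Complex convergence is encoded as a real sequence of errors tending to 0, so that limits of real
    sequences suffice; [is_pseries_has_psum] is the bridge to the filter formulation. *)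
Definition has_psum (a : nat -> C) (z l : C) : Prop :=
  is_lim_seq (fun n => Cmod (csum (fun k => a k * z ^ k)%C n - l)) 0.

Lemma is_series_sum_f_R0 (u : nat -> R) (l : R) :
  is_series u l <-> is_lim_seq (sum_f_R0 u) l.
Proof.
  unfold is_series. split; intros H.
  - apply is_lim_seq_ext with (sum_n u); [intros; apply sum_n_Reals|exact H].
  - apply (is_lim_seq_ext (sum_f_R0 u) (sum_n u) l) in H; [exact H|].
    intros; symmetry; apply sum_n_Reals.
Qed.

Lemma is_lim_seq_squeeze0 (u v : nat -> R) :
  (forall n, 0 <= u n <= v n) -> is_lim_seq v 0 -> is_lim_seq u 0.
Proof.
  intros H Hv. apply is_lim_seq_le_le with (fun _ => 0) v; auto.
  apply is_lim_seq_const.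
Qed.

Lemma has_psum_unique (a : nat -> C) z l l' : has_psum a z l -> has_psum a z l' -> l = l'.
Proof.
  intros H H'.
  assert (Hd : is_lim_seq (fun _ => Cmod (l - l')) 0).
  { pose proof (is_lim_seq_plus' _ _ _ _ H H') as Hs. rewrite Rplus_0_r in Hs.
    revert Hs. apply is_lim_seq_squeeze0. intros n; split; [apply Cmod_ge_0|].
    set (s := csum _ n). rewrite <- (Cmod_opp (s - l)%C).
    replace (l - l')%C with (- (s - l) + (s - l'))%C by ring. apply Cmod_triangle. }
  apply is_lim_seq_unique in Hd. rewrite Lim_seq_const in Hd. injection Hd as Hd.
  apply Cmod_eq_0 in Hd. replace l with (l - l' + l')%C by ring. rewrite Hd; ring.
Qed.

Lemma is_pseries_has_psum (a : nat -> C) z l :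
  @is_pseries C_AbsRing C_NormedModule a z l <-> has_psum a z l.
Proof.
  assert (E : forall n, @sum_n C_AbelianGroup
     (fun k => @scal C_AbsRing C_NormedModule (@pow_n C_AbsRing z k) (a k)) n
     = csum (fun k => a k * z ^ k)%C n).
  { intros n. rewrite csum_sum_n. apply sum_n_ext. intros k.
    change (@scal C_AbsRing C_NormedModule) with Cmult. apply Cmult_comm. }
  unfold is_pseries, is_series, has_psum. split; intros H.
  - apply is_lim_seq_spec. intros eps.
    specialize (H (fun y => Cmod (y - l) < eps)). unfold filtermap in H.
    assert (Hl : @locally (NormedModule.UniformSpace C_AbsRing C_NormedModule) l
                  (fun y => Cmod (y - l) < eps)).
    { apply (@locally_le_locally_norm C_AbsRing C_NormedModule).
      exists eps. intros y Hy. exact Hy. }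
    destruct (H Hl) as [N HN]. exists N. intros n Hn. specialize (HN n Hn).
    rewrite E in HN. rewrite Rminus_0_r, Rabs_pos_eq by apply Cmod_ge_0. exact HN.
  - intros P HP.
    apply (@locally_norm_le_locally C_AbsRing C_NormedModule) in HP.
    destruct HP as [eps HP]. apply is_lim_seq_spec in H. destruct (H eps) as [N HN].
    exists N. intros n Hn. apply HP. specialize (HN n Hn).
    rewrite Rminus_0_r, Rabs_pos_eq in HN by apply Cmod_ge_0.
    unfold ball_norm. rewrite E. exact HN.
Qed.

Lemma sum_f_R0_le_is_series (u : nat -> R) (N : nat) (l : R) :
  (forall n, 0 <= u n) -> is_series u l -> sum_f_R0 u N <= l.
Proof.
  intros Hu H. apply is_series_sum_f_R0 in H.
  apply (is_lim_seq_incr_compare _ _ H). intros n; simpl. specialize (Hu (S n)). lra.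
Qed.

Lemma ex_series_bounded (u : nat -> R) (M : R) :
  (forall n, 0 <= u n) -> (forall n, sum_f_R0 u n <= M) ->
  ex_series u /\ Series u <= M.
Proof.
  intros Hu HM.
  destruct (ex_finite_lim_seq_incr (sum_f_R0 u) M) as [l Hl]; [|exact HM|].
  { intros n; simpl. specialize (Hu (S n)). lra. }
  assert (Hs : is_series u l) by now apply is_series_sum_f_R0.
  split; [now exists l|]. rewrite (is_series_unique _ _ Hs).
  exact (is_lim_seq_le _ _ _ _ HM Hl (is_lim_seq_const M)).
Qed.

(** Abel's lemma: boundedness at t = (1 + rho) / 2 gives domination by a geometric series of ratio
    rho / t < 1. *)
Lemma disk_conv_bounded (a : nat -> C) :
  (forall t, 0 <= t < 1 -> exists M, forall n, Cmod (a n) * t ^ n <= M) ->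
  disk_conv a.
Proof.
  intros H rho Hr. set (t := (1 + rho) / 2).
  destruct (H t) as [M HM]; [unfold t; lra|].
  assert (Ht : 0 < t) by (unfold t; lra).
  apply (@ex_series_le R_AbsRing R_CompleteNormedModule _ (fun n => M * (rho / t) ^ n)).
  - intros n. change (norm ?x) with (Rabs x).
    rewrite Rabs_pos_eq by (apply Rmult_le_pos; [apply Cmod_ge_0|apply pow_le; lra]).
    replace (rho ^ n) with (t ^ n * (rho / t) ^ n).
    + rewrite <- Rmult_assoc. apply Rmult_le_compat_r; [|apply HM].
      apply pow_le. apply Rmult_le_pos; [lra|]. left; now apply Rinv_0_lt_compat.
    + rewrite <- Rpow_mult_distr. f_equal. field; lra.
  - apply (@ex_series_scal R_AbsRing R_NormedModule M (fun n => (rho / t) ^ n)).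
    apply ex_series_geom. rewrite Rabs_pos_eq.
    + apply (Rmult_lt_reg_r t); [lra|]. unfold Rdiv; rewrite Rmult_assoc, Rinv_l by lra.
      unfold t; lra.
    + apply Rmult_le_pos; [lra|]. left; now apply Rinv_0_lt_compat.
Qed.

Lemma ex_series_terms_bounded (u : nat -> R) :
  (forall n, 0 <= u n) -> ex_series u -> exists M, forall n, u n <= M.
Proof.
  intros Hu [l Hl]. exists l. intros n.
  apply Rle_trans with (sum_f_R0 u n); [|now apply sum_f_R0_le_is_series].
  destruct n as [|n]; simpl; [lra|].
  pose proof (cond_pos_sum u n Hu). lra.
Qed.

Lemma is_lim_seq_bounded (u : nat -> R) (l : R) :
  is_lim_seq u l -> exists M, forall n, u n <= M.
Proof.
  intros H. destruct (filterlim_bounded (K := R_AbsRing) (V := R_NormedModule) u) as [M HM].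
  { exists l. exact H. }
  exists M. intros n. eapply Rle_trans; [apply Rle_abs|apply HM].
Qed.

(** At a real point t the errors of the partial sums are at most some M. A term is the difference of
    two consecutive errors, hence at most 2 M; the term of index 0 has no predecessor and costs
    [Cmod (h t)]. *)
Lemma disk_conv_has_psum (a : nat -> C) (h : C -> C) :
  (forall z, Cmod z < 1 -> has_psum a z (h z)) -> disk_conv a.
Proof.
  intros H. apply disk_conv_bounded. intros t Ht.
  assert (Hz : Cmod (RtoC t) < 1) by (rewrite Cmod_R, Rabs_pos_eq; lra).
  destruct (is_lim_seq_bounded _ _ (H _ Hz)) as [M HM].
  exists (2 * M + Cmod (h t)). intros n. simpl in HM.
  replace (Cmod (a n) * t ^ n) with (Cmod (a n * t ^ n)%C).
  2:{ rewrite Cmod_mult, Cmod_pow, Cmod_R, Rabs_pos_eq by lra. reflexivity. }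
  destruct n as [|n].
  - specialize (HM 0%nat). cbn [csum] in HM. pose proof (Cmod_ge_0 (a 0%nat * t ^ 0 - h t)).
    replace (a 0%nat * t ^ 0)%C with ((a 0%nat * t ^ 0 - h t) + h t)%C by ring.
    eapply Rle_trans; [apply Cmod_triangle|lra].
  - pose proof (HM n) as H1. pose proof (HM (S n)) as H2. cbn [csum] in H2.
    set (s := csum _ n) in *. set (x := (a (S n) * _)%C) in *.
    change (a (S n) * t ^ S n)%C with x. pose proof (Cmod_ge_0 (h t)).
    replace x with ((s + x - h t) + - (s - h t))%C by ring.
    eapply Rle_trans; [apply Cmod_triangle|]. rewrite Cmod_opp. lra.
Qed.

(** * Absolutely convergent power series *)

Lemma Cmod_term (a : nat -> C) (z : C) n :
  Cmod (a n * z ^ n)%C = Cmod (a n) * Cmod z ^ n.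
Proof. now rewrite Cmod_mult, Cmod_pow. Qed.

Lemma Cmod_partial_sum_diff_le (a : nat -> C) (z : C) rho m n :
  Cmod z <= rho -> (m <= n)%nat ->
  Cmod (csum (fun k => a k * z ^ k)%C n - csum (fun k => a k * z ^ k)%C m)
  <= sum_f_R0 (fun k => Cmod (a k) * rho ^ k) n
     - sum_f_R0 (fun k => Cmod (a k) * rho ^ k) m.
Proof.
  intros Hz. induction 1 as [|n Hmn IH].
  - replace (_ - _)%C with (RtoC 0) by ring. rewrite Cmod_0; lra.
  - cbn [csum sum_f_R0].
    match goal with |- Cmod (?s + ?x - ?t) <= _ =>
      replace (s + x - t)%C with ((s - t) + x)%C by ring end.
    eapply Rle_trans; [apply Cmod_triangle|]. rewrite Cmod_term.
    assert (Cmod (a (S n)) * Cmod z ^ S n <= Cmod (a (S n)) * rho ^ S n).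
    { apply Rmult_le_compat_l; [apply Cmod_ge_0|]. apply pow_incr.
      split; [apply Cmod_ge_0|easy]. }
    lra.
Qed.

Lemma is_lim_seq_lower_bound (u : nat -> R) (c l : R) :
  (forall n, c <= u n) -> is_lim_seq u l -> c <= l.
Proof.
  intros H Hu. exact (is_lim_seq_le _ _ _ _ H (is_lim_seq_const c) Hu).
Qed.

Lemma is_lim_seq_upper_bound (u : nat -> R) (c l : R) :
  (forall n, u n <= c) -> is_lim_seq u l -> l <= c.
Proof.
  intros H Hu. exact (is_lim_seq_le _ _ _ _ H Hu (is_lim_seq_const c)).
Qed.

(** Compare with a later partial sum and let its index grow. The bound depends on z only through
    rho; this uniformity is essential in Parseval's identity, where the sample points move with the
    degree. *)
Lemma has_psum_tail_le (a : nat -> C) z l rho s n :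
  Cmod z <= rho -> is_series (fun k => Cmod (a k) * rho ^ k) s -> has_psum a z l ->
  Cmod (csum (fun k => a k * z ^ k)%C n - l)
  <= s - sum_f_R0 (fun k => Cmod (a k) * rho ^ k) n.
Proof.
  intros Hz Hs Hl.
  assert (Hr : 0 <= rho) by (eapply Rle_trans; [apply Cmod_ge_0|exact Hz]).
  set (A := sum_f_R0 (fun k => Cmod (a k) * rho ^ k)).
  set (S0 := csum (fun k => a k * z ^ k)%C).
  assert (Hb : forall m, (n <= m)%nat -> Cmod (S0 n - l) <= s - A n + Cmod (S0 m - l)).
  { intros m Hm. replace (S0 n - l)%C with (- (S0 m - S0 n) + (S0 m - l))%C by ring.
    eapply Rle_trans; [apply Cmod_triangle|]. apply Rplus_le_compat_r.
    rewrite Cmod_opp. eapply Rle_trans; [now apply (Cmod_partial_sum_diff_le a z rho)|].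
    fold A. assert (A m <= s); [|lra]. apply sum_f_R0_le_is_series; [|exact Hs].
    intros k. apply Rmult_le_pos; [apply Cmod_ge_0|now apply pow_le]. }
  assert (Hlim : is_lim_seq (fun m => s - A n + Cmod (S0 (m + n)%nat - l)) (s - A n + 0)).
  { apply is_lim_seq_plus'; [apply is_lim_seq_const|].
    apply (is_lim_seq_incr_n (fun m => Cmod (S0 m - l)%C) n). exact Hl. }
  rewrite Rplus_0_r in Hlim.
  apply is_lim_seq_lower_bound with (2 := Hlim). intros m. apply Hb. lia.
Qed.

Lemma has_psum_Cmod_le (a : nat -> C) z l rho s :
  Cmod z <= rho -> is_series (fun k => Cmod (a k) * rho ^ k) s -> has_psum a z l ->
  Cmod l <= s.
Proof.
  intros Hz Hs Hl. pose proof (has_psum_tail_le a z l rho s 0 Hz Hs Hl) as H.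
  cbn [csum sum_f_R0] in H.
  replace l with (- (a 0%nat * z ^ 0 - l) + a 0%nat * z ^ 0)%C by ring.
  eapply Rle_trans; [apply Cmod_triangle|]. rewrite Cmod_opp, Cmod_term.
  simpl pow in *. lra.
Qed.

Lemma has_psum_ex (a : nat -> C) z : disk_conv a -> Cmod z < 1 -> exists l, has_psum a z l.
Proof.
  intros Ha Hz.
  destruct (@ex_series_le C_AbsRing C_CompleteNormedModule
      (fun k => @scal C_AbsRing C_NormedModule (@pow_n C_AbsRing z k) (a k))
      (fun k => Cmod (a k) * Cmod z ^ k)) as [l Hl].
  - intros n.
    change (Cmod (Cmult (Cpow z n) (a n)) <= Cmod (a n) * Cmod z ^ n).
    rewrite Cmult_comm, Cmod_term. apply Rle_refl.
  - apply Ha. split; [apply Cmod_ge_0|easy].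
  - exists l. apply is_pseries_has_psum. exact Hl.
Qed.

Lemma has_psum_scale (a : nat -> C) (t z l : C) :
  has_psum (fun k => a k * t ^ k)%C z l <-> has_psum a (t * z)%C l.
Proof.
  unfold has_psum; split; apply is_lim_seq_ext; intros n; f_equal; f_equal;
    apply csum_ext; intros i _; rewrite Cpow_mult_l; ring.
Qed.

Lemma disk_conv_scale (a : nat -> C) (t : R) :
  0 <= t <= 1 -> disk_conv a -> disk_conv (fun k => a k * t ^ k)%C.
Proof.
  intros Ht Ha rho Hr.
  apply (@ex_series_le R_AbsRing R_CompleteNormedModule _ (fun n => Cmod (a n) * rho ^ n));
    [|now apply Ha].
  intros n. change (norm ?x) with (Rabs x). rewrite Cmod_term, Cmod_R.
  assert (0 <= Cmod (a n)) by apply Cmod_ge_0.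
  rewrite (Rabs_pos_eq t) by lra.
  assert (0 <= rho ^ n) by (apply pow_le; lra).
  assert (0 <= t ^ n <= 1).
  { split; [apply pow_le; lra|]. rewrite <- (pow1 n). apply pow_incr; lra. }
  rewrite Rabs_pos_eq by (repeat apply Rmult_le_pos; lra).
  apply Rmult_le_compat_r; [easy|]. rewrite <- (Rmult_1_r (Cmod (a n))) at 2.
  apply Rmult_le_compat_l; lra.
Qed.

Lemma has_psum_minus (a b : nat -> C) z la lb :
  has_psum a z la -> has_psum b z lb -> has_psum (fun n => a n - b n)%C z (la - lb)%C.
Proof.
  intros Ha Hb. pose proof (is_lim_seq_plus' _ _ _ _ Ha Hb) as H.
  rewrite Rplus_0_r in H. revert H. apply is_lim_seq_squeeze0.
  intros n; split; [apply Cmod_ge_0|].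
  rewrite (csum_ext _ (fun k => a k * z ^ k - b k * z ^ k)%C) by (intros; ring).
  rewrite csum_minus. set (x := csum _ n). set (y := csum _ n).
  replace (x - y - (la - lb))%C with ((x - la) + - (y - lb))%C by ring.
  eapply Rle_trans; [apply Cmod_triangle|]. rewrite Cmod_opp. lra.
Qed.

Lemma disk_conv_minus (a b : nat -> C) :
  disk_conv a -> disk_conv b -> disk_conv (fun n => a n - b n)%C.
Proof.
  intros Ha Hb rho Hr.
  apply (@ex_series_le R_AbsRing R_CompleteNormedModule _
    (fun n => Cmod (a n) * rho ^ n + Cmod (b n) * rho ^ n)).
  - intros n. change (norm ?x) with (Rabs x).
    assert (0 <= rho ^ n) by (apply pow_le; lra).
    rewrite Rabs_pos_eq by (apply Rmult_le_pos; [apply Cmod_ge_0|easy]).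
    rewrite <- Rmult_plus_distr_r. apply Rmult_le_compat_r; [easy|].
    eapply Rle_trans; [apply Cmod_triangle|]. rewrite Cmod_opp. lra.
  - apply (@ex_series_plus R_AbsRing R_NormedModule); auto.
Qed.

Lemma is_lim_seq_eventually_const (u : nat -> R) (N : nat) (c : R) :
  (forall n, (N <= n)%nat -> u n = c) -> is_lim_seq u c.
Proof.
  intros H. apply is_lim_seq_ext_loc with (fun _ => c); [|apply is_lim_seq_const].
  exists N. intros; now rewrite H.
Qed.

Lemma csum_eventually_zero (f : nat -> C) N n :
  (N <= n)%nat -> (forall i, (N < i)%nat -> f i = 0%C) -> csum f n = csum f N.
Proof.
  intros Hn H. induction Hn as [|n Hn IH]; [reflexivity|].
  simpl. rewrite IH, H by lia. ring.
Qed.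

Lemma has_psum_polynomial (q : nat -> C) N z :
  (forall i, (N < i)%nat -> q i = 0%C) -> has_psum q z (csum (fun k => q k * z ^ k)%C N).
Proof.
  intros H. apply is_lim_seq_eventually_const with N. intros n Hn.
  rewrite (csum_eventually_zero _ N n Hn) by (intros; rewrite H by easy; ring).
  replace (_ - _)%C with (RtoC 0) by ring. apply Cmod_0.
Qed.

Lemma disk_conv_polynomial (q : nat -> C) N :
  (forall i, (N < i)%nat -> q i = 0%C) -> disk_conv q.
Proof.
  intros H. apply (disk_conv_has_psum q (fun z => csum (fun k => q k * z ^ k)%C N)).
  intros; now apply has_psum_polynomial.
Qed.

Lemma sum_f_R0_incr (f : nat -> R) m n :
  (forall i, 0 <= f i) -> (m <= n)%nat -> sum_f_R0 f m <= sum_f_R0 f n.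
Proof.
  intros Hf. induction 1 as [|n Hn IH]; [lra|]. simpl. specialize (Hf (S n)). lra.
Qed.

Lemma sum_f_R0_minus (f g : nat -> R) n :
  sum_f_R0 (fun i => f i - g i) n = sum_f_R0 f n - sum_f_R0 g n.
Proof. induction n as [|n IH]; simpl; [reflexivity|rewrite IH; ring]. Qed.

(** The left side collects the products [u i * v j] with i, j <= n < i + j, and the right side is
    the same sum for the moduli. Convergence of complex Cauchy products thus reduces to the theorem
    for real series. *)
Lemma Cmod_cauchy_product_remainder_le (u v : nat -> C) n :
  Cmod (csum u n * csum v n
        - csum (fun m => csum (fun i => u i * v (m - i)%nat) m) n)%C
  <= sum_f_R0 (fun i => Cmod (u i)) n * sum_f_R0 (fun i => Cmod (v i)) n
     - sum_f_R0 (fun m => sum_f_R0 (fun i => Cmod (u i) * Cmod (v (m - i)%nat)) m) n.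
Proof.
  rewrite (csum_diagonals (fun i j => u i * v j)%C).
  rewrite (sum_f_R0_diagonals (fun i j => Cmod (u i) * Cmod (v j))).
  replace (csum u n * csum v n -
     csum (fun i => csum (fun j => u i * v j) (n - i)) n)%C with
     (csum (fun i => u i * (csum v n - csum v (n - i)))%C n).
  2:{ rewrite (csum_ext _ (fun i => u i * csum v n - csum (fun j => u i * v j) (n - i))%C).
      - rewrite csum_minus, csum_mult_r. ring.
      - intros i _. rewrite csum_mult_l. ring. }
  eapply Rle_trans; [apply Cmod_csum_le|].
  rewrite (Rmult_comm (sum_f_R0 _ n)), scal_sum, <- sum_f_R0_minus.
  apply sum_Rle. intros i Hi. rewrite Cmod_mult.
  rewrite (sum_eq (fun j => Cmod (u i) * Cmod (v j)) (fun j => Cmod (v j) * Cmod (u i)))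
    by (intros; ring).
  rewrite <- scal_sum, <- Rmult_minus_distr_l.
  apply Rmult_le_compat_l; [apply Cmod_ge_0|]. apply Cmod_csum_diff_le. lia.
Qed.

Lemma is_series_abs_cauchy_product (a b : nat -> C) rho :
  disk_conv a -> disk_conv b -> 0 <= rho < 1 ->
  is_series (fun n => sum_f_R0 (fun k => Cmod (a k) * rho ^ k
                        * (Cmod (b (n - k)%nat) * rho ^ (n - k))) n)
    (Series (fun n => Cmod (a n) * rho ^ n) * Series (fun n => Cmod (b n) * rho ^ n)).
Proof.
  intros Ha Hb Hr.
  assert (Hp : forall c n, 0 <= Cmod c * rho ^ n).
  { intros. apply Rmult_le_pos; [apply Cmod_ge_0|apply pow_le; lra]. }
  apply (is_series_mult (fun n => Cmod (a n) * rho ^ n) (fun n => Cmod (b n) * rho ^ n)).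
  - now apply Series_correct, Ha.
  - now apply Series_correct, Hb.
  - apply ex_series_ext with (2 := Ha rho Hr). intros; now rewrite Rabs_pos_eq.
  - apply ex_series_ext with (2 := Hb rho Hr). intros; now rewrite Rabs_pos_eq.
Qed.

Lemma disk_conv_conv (a b : nat -> C) :
  disk_conv a -> disk_conv b -> disk_conv (conv a b).
Proof.
  intros Ha Hb rho Hr.
  eapply (@ex_series_le R_AbsRing R_CompleteNormedModule);
    [|eexists; exact (is_series_abs_cauchy_product a b rho Ha Hb Hr)].
  intros n. change (norm ?x) with (Rabs x).
  rewrite Rabs_pos_eq by (apply Rmult_le_pos; [apply Cmod_ge_0|apply pow_le; lra]).
  unfold conv. rewrite Rmult_comm.
  eapply Rle_trans; [apply Rmult_le_compat_l; [apply pow_le; lra|apply Cmod_csum_le]|].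
  rewrite scal_sum. apply sum_Rle. intros k Hk. rewrite Cmod_mult.
  replace (rho ^ n) with (rho ^ k * rho ^ (n - k)).
  - apply Req_le. ring.
  - rewrite <- pow_add. f_equal; lia.
Qed.

Lemma has_psum_conv (a b : nat -> C) z la lb :
  disk_conv a -> disk_conv b -> Cmod z < 1 ->
  has_psum a z la -> has_psum b z lb -> has_psum (conv a b) z (la * lb)%C.
Proof.
  intros Ha Hb Hz Hla Hlb.
  set (rho := Cmod z). assert (Hr : 0 <= rho < 1) by (split; [apply Cmod_ge_0|easy]).
  set (u := fun k => (a k * z ^ k)%C). set (v := fun k => (b k * z ^ k)%C).
  assert (Hu : is_lim_seq (sum_f_R0 (fun n => Cmod (u n))) (Series (fun n => Cmod (a n) * rho ^ n))).
  { apply is_series_sum_f_R0. apply is_series_ext with (fun n => Cmod (a n) * rho ^ n).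
    - intros; unfold u; now rewrite Cmod_term.
    - now apply Series_correct, Ha. }
  assert (Hv : is_lim_seq (sum_f_R0 (fun n => Cmod (v n))) (Series (fun n => Cmod (b n) * rho ^ n))).
  { apply is_series_sum_f_R0. apply is_series_ext with (fun n => Cmod (b n) * rho ^ n).
    - intros; unfold v; now rewrite Cmod_term.
    - now apply Series_correct, Hb. }
  pose proof (is_series_abs_cauchy_product a b rho Ha Hb Hr) as Huv.
  apply is_series_sum_f_R0 in Huv.
  pose proof (is_lim_seq_minus' _ _ _ _ (is_lim_seq_mult' _ _ _ _ Hu Hv) Huv) as Hrem.
  rewrite Rminus_diag in Hrem.
  destruct (is_lim_seq_bounded _ _ Hu) as [M HM].
  (* Three errors tending to 0: the remainder above the diagonal, and the two pieces of U V - la lb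
     = U (V - lb) + lb (U - la), where U is bounded by M. *)
  assert (Hfin : is_lim_seq (fun n => 
     (sum_f_R0 (fun i => Cmod (u i)) n * sum_f_R0 (fun i => Cmod (v i)) n
     - sum_f_R0 (fun m => sum_f_R0 (fun k => Cmod (a k) * rho ^ k
                        * (Cmod (b (m - k)%nat) * rho ^ (m - k))) m) n)
     + (M * Cmod (csum v n - lb) + Cmod lb * Cmod (csum u n - la))) (0 + (M * 0 + Cmod lb * 0))).
  { apply is_lim_seq_plus'; [exact Hrem|].
    apply is_lim_seq_plus'; apply (is_lim_seq_scal_l _ _ 0); assumption. }
  replace (0 + (M * 0 + Cmod lb * 0)) with 0 in Hfin by ring.
  revert Hfin. apply is_lim_seq_squeeze0. intros n; split; [apply Cmod_ge_0|].
  rewrite (csum_ext _ (fun m => csum (fun i => u i * v (m - i)%nat) m)%C).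
  2:{ intros m _. unfold conv. rewrite <- csum_mult_r. apply csum_ext. intros i Hi.
      unfold u, v. replace (z ^ m)%C with (z ^ i * z ^ (m - i))%C; [ring|].
      rewrite <- Cpow_add_r. f_equal; lia. }
  pose proof (Cmod_cauchy_product_remainder_le u v n) as Hc.
  rewrite (sum_eq (fun m => sum_f_R0 (fun i => Cmod (u i) * Cmod (v (m - i)%nat)) m)
    (fun m => sum_f_R0 (fun k => Cmod (a k) * rho ^ k
                        * (Cmod (b (m - k)%nat) * rho ^ (m - k))) m)) in Hc.
  2:{ intros m _. apply sum_eq. intros i _. unfold u, v. now rewrite !Cmod_term. }
  set (W := csum (fun m => csum (fun i => u i * v (m - i)%nat) m)%C n) in *.
  assert (HU : Cmod (csum u n) <= M) by (eapply Rle_trans; [apply Cmod_csum_le|apply HM]).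
  replace (W - la * lb)%C with
    (- (csum u n * csum v n - W)
     + (csum u n * (csum v n - lb) + lb * (csum u n - la)))%C by ring.
  eapply Rle_trans; [apply Cmod_triangle|]. rewrite Cmod_opp.
  apply Rplus_le_compat; [exact Hc|].
  eapply Rle_trans; [apply Cmod_triangle|]. rewrite !Cmod_mult.
  apply Rplus_le_compat_r. apply Rmult_le_compat_r; [apply Cmod_ge_0|exact HU].
Qed.

(** * Parseval over the roots of unity and the l2 estimate *)

Definition cis (x : R) : C := (cos x, sin x).

Lemma cis_plus x y : cis (x + y) = (cis x * cis y)%C.
Proof. unfold cis, Cmult; simpl. rewrite cos_plus, sin_plus. f_equal; ring. Qed.

Lemma cis_0 : cis 0 = 1%C.
Proof. unfold cis. now rewrite cos_0, sin_0. Qed.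

Lemma cis_pow x n : (cis x ^ n)%C = cis (INR n * x).
Proof.
  induction n as [|n IH].
  - simpl INR. rewrite Rmult_0_l, cis_0. reflexivity.
  - rewrite Cpow_S, IH, S_INR, <- cis_plus. f_equal; ring.
Qed.

Lemma cis_conj x : Cconj (cis x) = cis (- x).
Proof. unfold cis, Cconj; simpl. now rewrite cos_neg, sin_neg. Qed.

Lemma Cmod_cis x : Cmod (cis x) = 1.
Proof.
  unfold Cmod, cis. simpl fst. simpl snd.
  replace (cos x ^ 2 + sin x ^ 2) with 1; [apply sqrt_1|].
  rewrite <- (sin2_cos2 x). unfold Rsqr. ring.
Qed.

Lemma cis_2PI_INR k : cis (2 * PI * INR k) = 1%C.
Proof.
  unfold cis. replace (2 * PI * INR k) with (0 + 2 * INR k * PI) by ring.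
  now rewrite cos_period, sin_period, cos_0, sin_0.
Qed.

Lemma cis_neq_1 x : 0 < x < 2 * PI -> cis x <> 1%C.
Proof.
  intros Hx H. injection H as Hc Hs.
  replace x with (2 * (x / 2)) in Hc by field. rewrite cos_2a_sin in Hc.
  assert (0 < sin (x / 2)) by (apply sin_gt_0; lra). nra.
Qed.

Lemma csum_geometric (x : C) n : ((x - 1) * csum (fun j => x ^ j) n)%C = (x ^ S n - 1)%C.
Proof.
  induction n as [|n IH]; [simpl; ring|].
  cbn [csum]. rewrite Cmult_plus_distr_l, IH, !Cpow_S. ring.
Qed.

Lemma csum_const (c : C) n : csum (fun _ => c) n = (INR (S n) * c)%C.
Proof.
  induction n as [|n IH]; [simpl; ring|].
  cbn [csum]. rewrite IH, (S_INR (S n)), RtoC_plus. ring.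
Qed.

Lemma csum_single (f : nat -> C) k n : (k <= n)%nat ->
  (forall i, (i <= n)%nat -> i <> k -> f i = 0%C) -> csum f n = f k.
Proof.
  induction n as [|n IH]; intros Hk H.
  - now replace k with 0%nat by lia.
  - cbn [csum]. destruct (Nat.eq_dec k (S n)) as [->|Hne].
    + rewrite csum_zero; [ring|]. intros i Hi; apply H; lia.
    + rewrite IH, (H (S n)) by (auto; lia). ring.
Qed.

Definition root_angle (D j : nat) : R := 2 * PI * INR j / INR (S D).

(** Each summand is a power of [cis t] with t = 2 PI (n - m) / (D + 1). For distinct n, m <= D the
    angle t is, up to sign, strictly between 0 and 2 PI, so [cis t] is a root of unity other than 1
    and the geometric sum vanishes. *)
Lemma roots_of_unity_orthogonal D n m : (n <= D)%nat -> (m <= D)%nat ->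
  csum (fun j => cis (root_angle D j) ^ n * Cconj (cis (root_angle D j) ^ m))%C D
  = if Nat.eq_dec n m then RtoC (INR (S D)) else 0%C.
Proof.
  intros Hn Hm. assert (HD : 0 < INR (S D)) by (apply lt_0_INR; lia).
  set (t := 2 * PI * (INR n - INR m) / INR (S D)).
  rewrite (csum_ext _ (fun j => cis t ^ j)%C).
  2:{ intros j _. rewrite !cis_pow, cis_conj, <- cis_plus. f_equal.
      unfold t, root_angle; field; lra. }
  destruct (Nat.eq_dec n m) as [->|Hnm].
  - unfold t. rewrite Rminus_diag, Rmult_0_r. unfold Rdiv; rewrite Rmult_0_l, cis_0.
    rewrite (csum_ext _ (fun _ => 1%C)) by (intros; apply Cpow_1_l).
    rewrite csum_const; ring.
  - assert (H1 : cis t <> 1%C).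
    { assert (Hpos : forall a b, (a < b <= D)%nat ->
         cis (2 * PI * (INR b - INR a) / INR (S D)) <> 1%C).
      { intros a b Hab. apply cis_neq_1. pose proof PI_RGT_0.
        assert (0 < INR b - INR a) by (apply Rlt_0_minus, lt_INR; lia).
        assert (INR b - INR a < INR (S D)).
        { pose proof (pos_INR a). assert (INR b < INR (S D)) by (apply lt_INR; lia). lra. }
        split.
        - apply Rdiv_lt_0_compat; [nra|easy].
        - apply (Rmult_lt_reg_r (INR (S D))); [easy|].
          unfold Rdiv; rewrite Rmult_assoc, Rinv_l by lra. nra. }
      destruct (Nat.lt_ge_cases m n) as [Hlt|Hge].
      - apply Hpos; lia.
      - intros E. apply (Hpos n m); [lia|].
        replace (2 * PI * (INR m - INR n) / INR (S D)) with (- t)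
          by (unfold t; field; lra).
        rewrite <- cis_conj, E. apply injective_projections; simpl; ring. }
    assert (H0 : ((cis t - 1) * csum (fun j => cis t ^ j) D)%C = 0%C).
    { rewrite csum_geometric.
      replace (cis t ^ S D)%C with (RtoC 1); [ring|].
      rewrite cis_pow. unfold t.
      replace (INR (S D) * (2 * PI * (INR n - INR m) / INR (S D)))
        with (2 * PI * INR n + - (2 * PI * INR m)) by (field; lra).
      rewrite cis_plus, <- cis_conj, !cis_2PI_INR. 
      apply injective_projections; simpl; ring. }
    destruct (Ceq_dec (csum (fun j => cis t ^ j)%C D) 0%C) as [E|E]; [exact E|].
    exfalso. apply Cmult_neq_0 in H0; [easy| |exact E].
    intros E'. apply H1. replace (cis t) with (cis t - 1 + 1)%C by ring.
    rewrite E'; ring.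
Qed.

Lemma RtoC_Cmod2 (z : C) : RtoC (Cmod z ^ 2) = (z * Cconj z)%C.
Proof. apply Cmod2_conj. Qed.

Lemma discrete_parseval (p : nat -> C) D :
  sum_f_R0 (fun j => Cmod (csum (fun n => p n * cis (root_angle D j) ^ n)%C D) ^ 2) D
  = INR (S D) * sum_f_R0 (fun n => Cmod (p n) ^ 2) D.
Proof.
  apply RtoC_inj. rewrite RtoC_mult, <- !csum_RtoC.
  rewrite (csum_ext _ (fun j => csum (fun n => csum (fun m =>
     p n * Cconj (p m) * (cis (root_angle D j) ^ n * Cconj (cis (root_angle D j) ^ m))) D) D)%C).
  2:{ intros j _. rewrite RtoC_Cmod2, csum_conj, <- csum_mult_r. apply csum_ext; intros n _.
      rewrite <- csum_mult_l. apply csum_ext; intros m _. rewrite Cmult_conj. ring. }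
  rewrite csum_switch, <- csum_mult_l. apply csum_ext; intros n Hn.
  rewrite csum_switch, (csum_single _ n).
  - rewrite csum_mult_l, roots_of_unity_orthogonal by easy.
    destruct (Nat.eq_dec n n); [|easy]. rewrite RtoC_Cmod2. ring.
  - exact Hn.
  - intros m Hm Hmn. rewrite csum_mult_l, roots_of_unity_orthogonal by easy.
    destruct (Nat.eq_dec n m); [congruence|]. ring.
Qed.

Lemma Cmod_sqr_diff_le (x y : C) (M e : R) :
  Cmod x <= M -> Cmod y <= M -> Cmod (x - y) <= e -> Cmod x ^ 2 <= Cmod y ^ 2 + 2 * M * e.
Proof.
  intros Hx Hy He. pose proof (Cmod_ge_0 x). pose proof (Cmod_ge_0 y).
  assert (Cmod x <= Cmod y + e).
  { replace x with (y + (x - y))%C by ring. eapply Rle_trans; [apply Cmod_triangle|lra]. }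
  pose proof (Cmod_ge_0 (x - y)). nra.
Qed.

Section Domination.
Variables (p q : nat -> C) (F G : C -> C).
Hypotheses (Hp : disk_conv p) (Hq : disk_conv q)
  (HF : forall z, Cmod z < 1 -> has_psum p z (F z)) (HG : forall z, Cmod z < 1 -> has_psum q z (G z))
  (HFG : forall z, Cmod z < 1 -> Cmod (F z) <= Cmod (G z)).

(** Replace F and G by their partial sums of degree D, for which Parseval over D + 1 nodes is exact.
    Passing between a function and its partial sum changes the squared modulus by at most 2 [sp]
    [ep D], respectively 2 [sq] [eq D], uniformly over the nodes; N stays fixed while D tends to
    infinity. *)
Lemma has_psum_dominated_l2_radius rho Q N : 0 <= rho < 1 ->
  (forall D, sum_f_R0 (fun n => Cmod (q n * rho ^ n)%C ^ 2) D <= Q) ->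
  sum_f_R0 (fun n => Cmod (p n * rho ^ n)%C ^ 2) N <= Q.
Proof.
  intros Hr HQ.
  set (sp := Series (fun n => Cmod (p n) * rho ^ n)).
  set (sq := Series (fun n => Cmod (q n) * rho ^ n)).
  set (ep := fun D => sp - sum_f_R0 (fun n => Cmod (p n) * rho ^ n) D).
  set (eq := fun D => sq - sum_f_R0 (fun n => Cmod (q n) * rho ^ n) D).
  assert (Hsp : is_series (fun n => Cmod (p n) * rho ^ n) sp) by now apply Series_correct, Hp.
  assert (Hsq : is_series (fun n => Cmod (q n) * rho ^ n) sq) by now apply Series_correct, Hq.
  assert (Hpos : forall c n, 0 <= Cmod c * rho ^ n).
  { intros. apply Rmult_le_pos; [apply Cmod_ge_0|apply pow_le; lra]. }
  assert (Hbd : forall a z s, Cmod z = rho -> is_series (fun n => Cmod (a n) * rho ^ n) s ->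
     forall D, Cmod (csum (fun n => a n * z ^ n)%C D) <= s).
  { intros a z s Hz Hs D. eapply Rle_trans; [apply Cmod_csum_le|].
    erewrite sum_eq by (intros; rewrite Cmod_term, Hz; reflexivity).
    apply sum_f_R0_le_is_series; auto. }
  assert (HD : forall D, (N <= D)%nat ->
    sum_f_R0 (fun n => Cmod (p n * rho ^ n)%C ^ 2) N <= Q + (2 * sp * ep D + 2 * sq * eq D)).
  { intros D HND.
    apply Rle_trans with (sum_f_R0 (fun n => Cmod (p n * rho ^ n)%C ^ 2) D).
    { apply sum_f_R0_incr; [intros; apply pow2_ge_0|easy]. }
    apply Rle_trans with (sum_f_R0 (fun n => Cmod (q n * rho ^ n)%C ^ 2) D
                          + (2 * sp * ep D + 2 * sq * eq D)); [|specialize (HQ D); lra].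
    assert (HSD : 0 < INR (S D)) by (apply lt_0_INR; lia).
    apply (Rmult_le_reg_l (INR (S D))); [easy|].
    rewrite Rmult_plus_distr_l, <- !discrete_parseval.
    rewrite (Rmult_comm (INR (S D))), <- sum_cte, <- sum_plus.
    apply sum_Rle. intros j _. set (w := cis (root_angle D j)). set (z := (rho * w)%C).
    assert (Hz : Cmod z = rho).
    { unfold z, w. rewrite Cmod_mult, Cmod_cis, Cmod_R, Rabs_pos_eq by lra. ring. }
    assert (Hz1 : Cmod z < 1) by lra.
    assert (E : forall a, csum (fun n => a n * rho ^ n * w ^ n)%C D
                          = csum (fun n => a n * z ^ n)%C D).
    { intros a. apply csum_ext; intros; unfold z. rewrite Cpow_mult_l; ring. }
    rewrite !E.
    pose proof (has_psum_tail_le p z _ rho sp D (Req_le _ _ Hz) Hsp (HF z Hz1)) as Tp.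
    pose proof (has_psum_tail_le q z _ rho sq D (Req_le _ _ Hz) Hsq (HG z Hz1)) as Tq.
    pose proof (has_psum_Cmod_le p z _ rho sp (Req_le _ _ Hz) Hsp (HF z Hz1)) as Bp.
    pose proof (has_psum_Cmod_le q z _ rho sq (Req_le _ _ Hz) Hsq (HG z Hz1)) as Bq.
    pose proof (Cmod_sqr_diff_le _ _ sp _ (Hbd p z sp Hz Hsp D) Bp Tp) as H1.
    replace (csum (fun n => q n * z ^ n)%C D - G z)%C
      with (- (G z - csum (fun n => q n * z ^ n)%C D))%C in Tq by ring.
    rewrite Cmod_opp in Tq.
    pose proof (Cmod_sqr_diff_le _ _ sq _ Bq (Hbd q z sq Hz Hsq D) Tq) as H2.
    assert (H3 : Cmod (F z) ^ 2 <= Cmod (G z) ^ 2).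
    { apply pow_incr; split; [apply Cmod_ge_0|now apply HFG]. }
    unfold ep, eq. lra. }
  assert (Hlim : is_lim_seq (fun D => Q + (2 * sp * ep (D + N)%nat + 2 * sq * eq (D + N)%nat))
                   (Q + (2 * sp * 0 + 2 * sq * 0))).
  { assert (Hz : forall u s, is_series u s ->
       is_lim_seq (fun D => s - sum_f_R0 u (D + N)) 0).
    { intros u s Hs. apply is_series_sum_f_R0 in Hs.
      apply (is_lim_seq_incr_n _ N) in Hs.
      pose proof (is_lim_seq_minus' _ _ _ _ (is_lim_seq_const s) Hs) as H.
      now rewrite Rminus_diag in H. }
    apply is_lim_seq_plus'; [apply is_lim_seq_const|].
    apply is_lim_seq_plus'; apply (is_lim_seq_scal_l _ _ 0); now apply Hz. }
  replace (Q + (2 * sp * 0 + 2 * sq * 0)) with Q in Hlim by ring.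
  apply is_lim_seq_lower_bound with (2 := Hlim). intros D; apply HD; lia.
Qed.

(** The bound Q is the same for all radii and the sum is finite, so the radius 1 - 1/(k + 1) may
    tend to 1. *)
Lemma has_psum_dominated_l2 Q N :
  (forall D, sum_f_R0 (fun n => Cmod (q n) ^ 2) D <= Q) ->
  sum_f_R0 (fun n => Cmod (p n) ^ 2) N <= Q.
Proof.
  intros HQ.
  assert (Hr : forall rho, 0 <= rho < 1 ->
    sum_f_R0 (fun n => Cmod (p n) ^ 2 * (rho ^ n) ^ 2) N <= Q).
  { intros rho Hr.
    rewrite (sum_eq _ (fun n => Cmod (p n * rho ^ n)%C ^ 2)).
    2:{ intros n _. rewrite Cmod_term, Cmod_R, Rabs_pos_eq by lra. ring. }
    apply has_psum_dominated_l2_radius; [easy|]. intros D.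
    eapply Rle_trans; [|apply (HQ D)]. apply sum_Rle. intros n _.
    rewrite Cmod_term, Cmod_R, Rabs_pos_eq by lra.
    assert (0 <= rho ^ n <= 1).
    { split; [apply pow_le; lra|]. rewrite <- (pow1 n). apply pow_incr; lra. }
    apply pow_incr. pose proof (Cmod_ge_0 (q n)). split; [nra|nra]. }
  assert (Hlim : is_lim_seq (fun k => sum_f_R0 (fun n => Cmod (p n) ^ 2 * ((1 - / INR (S k)) ^ n) ^ 2) N)
                   (sum_f_R0 (fun n => Cmod (p n) ^ 2) N)).
  { assert (Hk : is_lim_seq (fun k => 1 - / INR (S k)) 1).
    { assert (H0 : is_lim_seq (fun k => / INR (S k)) 0).
      { apply (is_lim_seq_inv (fun k => INR (S k)) p_infty); [|easy].
        apply (is_lim_seq_incr_1 INR). apply is_lim_seq_INR. }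
      pose proof (is_lim_seq_minus' _ _ _ _ (is_lim_seq_const 1) H0) as H.
      now rewrite Rminus_0_r in H. }
    assert (Hpow : forall n, is_lim_seq (fun k => ((1 - / INR (S k)) ^ n)) 1).
    { induction n as [|n IH]; [apply is_lim_seq_const|].
      pose proof (is_lim_seq_mult' _ _ _ _ Hk IH) as H. now rewrite Rmult_1_r in H. }
    assert (Ht : forall n, is_lim_seq (fun k => Cmod (p n) ^ 2 * ((1 - / INR (S k)) ^ n) ^ 2) (Cmod (p n) ^ 2)).
    { intros n.
      pose proof (is_lim_seq_mult' _ _ _ _ (is_lim_seq_const (Cmod (p n) ^ 2))
                   (is_lim_seq_mult' _ _ _ _ (Hpow n) (Hpow n))) as H.
      rewrite !Rmult_1_r in H. revert H. apply is_lim_seq_ext. intros k; ring. }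
    clear - Ht. induction N as [|m IH]; simpl; [apply (Ht 0%nat)|].
    apply is_lim_seq_plus'; [exact IH|apply (Ht (S m))]. }
  apply is_lim_seq_upper_bound with (2 := Hlim). intros k. apply Hr.
  assert (0 < / INR (S k) <= 1).
  { assert (1 <= INR (S k)) by (apply (le_INR 1); lia).
    split; [apply Rinv_0_lt_compat; lra|]. rewrite <- Rinv_1. apply Rinv_le_contravar; lra. }
  lra.
Qed.
End Domination.

Definition truncate (q : nat -> C) (N n : nat) : C := if le_dec n N then q n else 0%C.

(** The coefficients of the product up to degree N see only the truncation of q, which is a
    polynomial and is multiplied pointwise by a function of modulus at most M. Nothing is asked of
    the growth of q, so it may later be a formal reciprocal. *)
Lemma conv_l2_le (a : nat -> C) (F : C -> C) (M : R) (q : nat -> C) (N : nat) :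
  disk_conv a -> (forall z, Cmod z < 1 -> has_psum a z (F z)) ->
  (forall z, Cmod z < 1 -> Cmod (F z) <= M) ->
  sum_f_R0 (fun n => Cmod (conv a q n) ^ 2) N <= M ^ 2 * sum_f_R0 (fun n => Cmod (q n) ^ 2) N.
Proof.
  intros Ha HF HM. set (t := truncate q N).
  assert (Ht : forall i, (N < i)%nat -> t i = 0%C).
  { intros i Hi. unfold t, truncate. destruct (le_dec i N); [lia|easy]. }
  assert (Ht' : forall i, (i <= N)%nat -> t i = q i).
  { intros i Hi. unfold t, truncate. destruct (le_dec i N); [easy|lia]. }
  assert (HMt : forall i, (N < i)%nat -> (RtoC M * t i)%C = 0%C).
  { intros i Hi; rewrite Ht by easy; ring. }
  pose proof (disk_conv_polynomial t N Ht) as Hdt.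
  assert (HM0 : 0 <= M).
  { eapply Rle_trans; [apply Cmod_ge_0|apply (HM 0%C)]. rewrite Cmod_0; lra. }
  rewrite (sum_eq _ (fun n => Cmod (conv a t n) ^ 2)).
  2:{ intros n Hn. do 2 f_equal. apply conv_ext; [easy|]. intros; symmetry; apply Ht'; lia. }
  apply (has_psum_dominated_l2 (conv a t) (fun n => M * t n)%C
     (fun z => F z * csum (fun k => t k * z ^ k) N)%C
     (fun z => csum (fun k => M * t k * z ^ k) N)%C).
  - now apply disk_conv_conv.
  - exact (disk_conv_polynomial _ N HMt).
  - intros z Hz. apply has_psum_conv; auto. now apply has_psum_polynomial.
  - intros z Hz. now apply has_psum_polynomial.
  - intros z Hz. rewrite (csum_ext (fun k => M * t k * z ^ k)%C (fun k => M * (t k * z ^ k))%C)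
      by (intros; ring).
    rewrite csum_mult_l, !Cmod_mult, Cmod_R, (Rabs_pos_eq M) by easy.
    apply Rmult_le_compat_r; [apply Cmod_ge_0|now apply HM].
  - intros D. rewrite scal_sum.
    apply Rle_trans with (sum_f_R0 (fun n => Cmod (M * t n)%C ^ 2) (max D N)).
    { apply sum_f_R0_incr; [intros; apply pow2_ge_0|lia]. }
    assert (E : forall m, (N <= m)%nat ->
      sum_f_R0 (fun n => Cmod (M * t n)%C ^ 2) m = sum_f_R0 (fun n => Cmod (M * t n)%C ^ 2) N).
    { induction 1 as [|m Hm IH]; [easy|]. cbn [sum_f_R0]. rewrite IH, HMt, Cmod_0 by lia. ring. }
    rewrite E by lia. apply Req_le, sum_eq. intros n Hn.
    rewrite Cmod_mult, Cmod_R, Rabs_pos_eq, Ht' by easy. ring.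
Qed.

(** * Carlson's coefficient bounds *)

Lemma sum_f_R0_rev (f : nat -> R) n : sum_f_R0 (fun i => f (n - i)%nat) n = sum_f_R0 f n.
Proof.
  apply RtoC_inj. rewrite <- !csum_RtoC. exact (csum_rev (fun i => RtoC (f i)) n).
Qed.

Lemma sum_f_R0_eventually_zero (f : nat -> R) N n :
  (N <= n)%nat -> (forall i, (N < i)%nat -> f i = 0) -> sum_f_R0 f n = sum_f_R0 f N.
Proof.
  intros Hn H. induction Hn as [|n Hn IH]; [reflexivity|].
  simpl. rewrite IH, H by lia. ring.
Qed.

Lemma C_phase (z : C) : exists u : C, Cmod u = 1 /\ z = (u * Cmod z)%C.
Proof.
  destruct (Ceq_dec z 0%C) as [->|Hz].
  - exists 1%C. rewrite Cmod_0, Cmod_1. split; [easy|ring].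
  - exists (z / Cmod z)%C.
    assert (H : RtoC (Cmod z) <> 0%C).
    { intros E. apply RtoC_inj in E. now apply Hz, Cmod_eq_0. }
    split; [|field; exact H].
    rewrite Cmod_div by exact H. rewrite Cmod_R, Rabs_pos_eq by apply Cmod_ge_0.
    field. intros E. apply H. now rewrite E.
Qed.

Lemma conv_plus_l (a b c : nat -> C) n :
  conv (fun i => a i + b i)%C c n = (conv a c n + conv b c n)%C.
Proof. unfold conv. rewrite <- csum_plus. apply csum_ext; intros; ring. Qed.

Lemma conv_plus_r (a b c : nat -> C) n :
  conv c (fun i => a i + b i)%C n = (conv c a n + conv c b n)%C.
Proof. unfold conv. rewrite <- csum_plus. apply csum_ext; intros; ring. Qed.

Section Carlson.
Variables (a : nat -> C) (F : C -> C).
Hypotheses (Ha : disk_conv a) (HF : forall z, Cmod z < 1 -> has_psum a z (F z))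
  (HF1 : forall z, Cmod z < 1 -> Cmod (F z) <= 1).

(** Read the coefficient as that of (a q) q. The inequality of the means splits each product into
    halves of squares, and multiplication by a does not increase the l2 norm. *)
Lemma Cmod_coef_square_le (q : nat -> C) N :
  Cmod (conv a (conv q q) N) <= sum_f_R0 (fun n => Cmod (q n) ^ 2) N.
Proof.
  rewrite <- conv_assoc. unfold conv at 1.
  eapply Rle_trans; [apply Cmod_csum_le|].
  pose proof (conv_l2_le a F 1 q N Ha HF HF1) as H. rewrite pow1, Rmult_1_l in H.
  apply Rle_trans with (sum_f_R0 (fun i => Cmod (conv a q i) ^ 2 * / 2
                          + Cmod (q (N - i)%nat) ^ 2 * / 2) N).
  - apply sum_Rle. intros i _. rewrite Cmod_mult.
    pose proof (pow2_ge_0 (Cmod (conv a q i) - Cmod (q (N - i)%nat))). nra.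
  - rewrite sum_plus, <- !scal_sum.
    rewrite (sum_f_R0_rev (fun i => Cmod (q i) ^ 2)). lra.
Qed.

Section Test.
Variables (x : nat -> C) (n N : nat).
Hypotheses (Hx : forall j, (n < j)%nat -> x j = 0%C) (HnN : (n < N)%nat).

(* The test polynomial is [q = 1 + v] with [v = sum_{j<=n} x_j z^{N-j}]; as [v] starts at
   degree [N - n], only the degree [2 (N - n)] term of [v^2] can reach degree [N]. *)
Let v (i : nat) : C := x (N - i)%nat.

Lemma conv_test_square i : conv (fun i => cone i + v i)%C (fun i => cone i + v i)%C i
  = (cone i + 2 * v i + conv v v i)%C.
Proof.
  rewrite conv_plus_l, !conv_plus_r, !conv_cone_l, (conv_comm v), conv_cone_l. ring.
Qed.

(** The three terms on the left are the coefficients of degree N in a, 2 a v and a v^2, from q^2 = 1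
    + 2 v + v^2. *)
Lemma Cmod_coef_test_le :
  Cmod (a N + 2 * csum (fun j => x j * a j) n + conv a (conv v v) N)%C
  <= 1 + sum_f_R0 (fun j => Cmod (x j) ^ 2) n.
Proof.
  pose proof (Cmod_coef_square_le (fun i => cone i + v i)%C N) as H.
  rewrite (conv_ext a a _ (fun i => cone i + 2 * v i + conv v v i)%C) in H
    by (intros; auto using conv_test_square).
  rewrite !conv_plus_r, (conv_comm a cone), conv_cone_l in H.
  assert (E : conv a (fun i => 2 * v i)%C N = (2 * csum (fun j => x j * a j) n)%C).
  { rewrite <- csum_mult_l, <- (csum_eventually_zero _ n N); [|lia|].
    - apply csum_ext. intros i Hi. unfold v.
      replace (N - (N - i))%nat with i by lia. ring.
    - intros i Hi. rewrite Hx by easy. ring. }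
  rewrite E in H. eapply Rle_trans; [exact H|].
  rewrite <- (sum_f_R0_rev (fun i => Cmod (cone i + v i)%C ^ 2)).
  destruct N as [|N']; [lia|].
  (* Since n < N, the polynomial v has no constant term, and the squared norms of 1 and v simply add
     up. *)
  assert (Hz : x (S N') = 0%C) by (apply Hx; lia).
  cbn [sum_f_R0]. unfold v. rewrite Nat.sub_diag, Nat.sub_0_r, Hz.
  replace (Cmod (cone 0 + 0)%C) with 1.
  2:{ simpl. replace (1 + 0)%C with (RtoC 1) by ring. now rewrite Cmod_1. }
  apply Req_le. rewrite <- (sum_f_R0_eventually_zero _ n N'); [|lia|].
  - rewrite Rplus_comm, pow1. f_equal. apply sum_eq. intros i Hi.
    replace (S N' - i)%nat with (S (N' - i)) by lia. simpl cone.
    replace (S N' - S (N' - i))%nat with i by lia.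
    now rewrite Cplus_0_l.
  - intros i Hi. rewrite Hx, Cmod_0 by easy. ring.
Qed.

Lemma conv_test_vanish i : (i < 2 * (N - n))%nat -> (i <= N)%nat -> conv v v i = 0%C.
Proof.
  intros Hi HiN. apply csum_zero. intros l Hl. unfold v.
  destruct (le_lt_dec (N - l) n).
  - rewrite (Hx (N - (i - l))) by lia. ring.
  - rewrite (Hx (N - l)) by lia. ring.
Qed.
End Test.

(** Take x_j = s conj(a_j) with s the phase of a_N. Then a_N and the linear term share the phase s,
    and their moduli add: |a_N| + 2 sigma <= 1 + sigma. The degree N = 2n + 1 is just below 2 (N -
    n) = 2n + 2, where v^2 starts. *)
Lemma carlson_odd n :
  Cmod (a (2 * n + 1)%nat) <= 1 - sum_f_R0 (fun j => Cmod (a j) ^ 2) n.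
Proof.
  set (N := (2 * n + 1)%nat). destruct (C_phase (a N)) as [s [Hs Es]].
  set (x := fun j => if le_dec j n then (s * Cconj (a j))%C else 0%C).
  assert (Hx : forall j, (n < j)%nat -> x j = 0%C).
  { intros j Hj; unfold x; destruct (le_dec j n); [lia|easy]. }
  assert (Hx' : forall j, (j <= n)%nat -> x j = (s * Cconj (a j))%C).
  { intros j Hj; unfold x; destruct (le_dec j n); [easy|lia]. }
  pose proof (Cmod_coef_test_le x n N Hx ltac:(lia)) as H.
  set (sigma := sum_f_R0 (fun j => Cmod (a j) ^ 2) n).
  replace (sum_f_R0 (fun j => Cmod (x j) ^ 2) n) with sigma in H.
  2:{ apply sum_eq. intros j Hj. rewrite Hx', Cmod_mult, Hs, Cmod_conj by easy. ring. }
  replace (conv a _ N) with (RtoC 0) in H.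
  2:{ symmetry; apply csum_zero. intros i Hi.
      rewrite (conv_test_vanish x n N Hx) by lia. ring. }
  replace (csum _ n) with (s * sigma)%C in H.
  2:{ unfold sigma. rewrite <- csum_RtoC, <- csum_mult_l. apply csum_ext. intros j Hj.
      rewrite Hx', RtoC_Cmod2 by easy. ring. }
  rewrite Es in H at 1.
  replace (s * Cmod (a N) + 2 * (s * sigma) + 0)%C
    with (s * RtoC (Cmod (a N) + 2 * sigma))%C in H
    by (rewrite RtoC_plus, RtoC_mult; ring).
  rewrite Cmod_mult, Hs, Cmod_R in H.
  pose proof (Rle_abs (Cmod (a N) + 2 * sigma)). lra.
Qed.

(** Here N = 2n equals 2 (N - n), so v^2 contributes exactly a_0 y^2 with y = x_n. The phase of y
    makes y a_n have phase s, while a_0 y^2 has an uncontrolled phase and is paid for by its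
    modulus. *)
Lemma carlson_even m :
  Cmod (a (2 * S m)%nat)
  <= 1 - sum_f_R0 (fun j => Cmod (a j) ^ 2) m - Cmod (a (S m)) ^ 2 / (1 + Cmod (a 0%nat)).
Proof.
  set (n := S m). set (N := (2 * n)%nat). destruct (C_phase (a N)) as [s [Hs Es]].
  destruct (C_phase (a n)) as [u [Hu Eu]].
  (* With |y| = t, the gain from x_n is 2 t |a_n| - t^2 - |a_0| t^2; this t maximises it, with value
     |a_n|^2 / (1 + |a_0|). *)
  set (t := Cmod (a n) / (1 + Cmod (a 0%nat))).
  pose proof (Cmod_ge_0 (a 0%nat)) as H0.
  assert (Ht : 0 <= t).
  { apply Rmult_le_pos; [apply Cmod_ge_0|]. left; apply Rinv_0_lt_compat; lra. }
  set (y := (t * s * Cconj u)%C).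
  assert (Hy : Cmod y = t).
  { unfold y. rewrite !Cmod_mult, Cmod_conj, Hs, Hu, Cmod_R, Rabs_pos_eq by easy. ring. }
  set (x := fun j => if le_dec j m then (s * Cconj (a j))%C
                     else if Nat.eq_dec j n then y else 0%C).
  assert (Hx : forall j, (n < j)%nat -> x j = 0%C).
  { intros j Hj; unfold x; destruct (le_dec j m); [lia|].
    destruct (Nat.eq_dec j n); [lia|easy]. }
  assert (Hx' : forall j, (j <= m)%nat -> x j = (s * Cconj (a j))%C).
  { intros j Hj; unfold x; destruct (le_dec j m); [easy|lia]. }
  assert (Hxn : x n = y).
  { unfold x; destruct (le_dec n m); [lia|]. now destruct (Nat.eq_dec n n). }
  pose proof (Cmod_coef_test_le x n N Hx ltac:(lia)) as H.
  set (tau := sum_f_R0 (fun j => Cmod (a j) ^ 2) m).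
  replace (sum_f_R0 (fun j => Cmod (x j) ^ 2) n) with (tau + t ^ 2) in H.
  2:{ unfold n. cbn [sum_f_R0]. fold n. rewrite Hxn, Hy. f_equal.
      apply sum_eq. intros j Hj. rewrite Hx', Cmod_mult, Hs, Cmod_conj by easy. ring. }
  replace (conv a _ N) with (a 0%nat * y ^ 2)%C in H.
  2:{ symmetry. unfold conv at 1. rewrite (csum_single _ 0); [|lia|].
      - f_equal. rewrite Nat.sub_0_r. unfold conv. rewrite (csum_single _ n); [|lia|].
        + replace (N - n)%nat with n by lia. replace (N - n)%nat with n by lia.
          rewrite Hxn. simpl; ring.
        + intros i Hi Hin. destruct (le_lt_dec i n).
          * rewrite (Hx (N - i)%nat) by lia. ring.
          * rewrite (Hx (N - (N - i))%nat) by lia. ring.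
      - intros i Hi Hi0. rewrite (conv_test_vanish x n N Hx) by lia. ring. }
  replace (csum _ n) with (s * RtoC (tau + t * Cmod (a n)))%C in H.
  2:{ unfold n. cbn [csum]. fold n.
      rewrite (csum_ext _ (fun j => s * RtoC (Cmod (a j) ^ 2))%C).
      - rewrite csum_mult_l, csum_RtoC. fold tau.
        assert (E : (a n * Cconj u)%C = RtoC (Cmod (a n))).
        { transitivity (Cmod (a n) * (u * Cconj u))%C; [rewrite Eu at 1; ring|].
          rewrite <- Cmod2_conj, Hu, pow1. ring. }
        rewrite Hxn, RtoC_plus, RtoC_mult, <- E. unfold y. ring.
      - intros j Hj. rewrite Hx', RtoC_Cmod2 by easy. ring. }
  set (w := (a 0%nat * y ^ 2)%C) in *.
  assert (Hw : Cmod w = Cmod (a 0%nat) * t ^ 2) by (unfold w; now rewrite Cmod_mult, Cmod_pow, Hy).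
  set (K := Cmod (a N) + 2 * (tau + t * Cmod (a n))).
  assert (HK : K <= 1 + (tau + t ^ 2) + Cmod (a 0%nat) * t ^ 2).
  { rewrite <- Hw. eapply Rle_trans; [|apply Rplus_le_compat_r, H].
    rewrite Es. set (r := Cmod (a N)) in *.
    rewrite <- (Cmod_opp w). eapply Rle_trans; [|apply Cmod_triangle].
    replace (s * r + 2 * (s * (tau + t * Cmod (a n))%R) + w + - w)%C
      with (s * RtoC K)%C by (unfold K; rewrite !RtoC_plus, !RtoC_mult, !RtoC_plus, ?RtoC_mult; ring).
    rewrite Cmod_mult, Hs, Cmod_R, Rmult_1_l. apply Rle_abs. }
  assert (E : Cmod (a n) = t * (1 + Cmod (a 0%nat))) by (unfold t; field; lra).
  replace (Cmod (a n) ^ 2 / (1 + Cmod (a 0%nat))) with (t * Cmod (a n))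
    by (unfold t; field; lra).
  unfold K in HK. rewrite E in *. nra.
Qed.
End Carlson.

(** * Derivatives of power series *)

Definition dcoef (a : nat -> C) (n : nat) : C := (INR (S n) * a (S n))%C.

Lemma Cmod_INR_mult n (z : C) : Cmod (INR n * z)%C = INR n * Cmod z.
Proof. rewrite Cmod_mult, Cmod_R, Rabs_pos_eq by apply pos_INR. reflexivity. Qed.

Lemma disk_conv_dcoef (a : nat -> C) : disk_conv a -> disk_conv (dcoef a).
Proof.
  intros Ha. apply disk_conv_bounded. intros t Ht.
  set (d := (1 - t) / 2). set (s := t + d).
  assert (Hd : 0 < d <= 1) by (unfold d; lra).
  assert (Hs : 0 < s < 1) by (unfold s, d; lra).
  assert (Hpos : forall k, 0 <= Cmod (a k) * s ^ k).
  { intros k. apply Rmult_le_pos; [apply Cmod_ge_0|apply pow_le; lra]. }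
  destruct (ex_series_terms_bounded _ Hpos (Ha s ltac:(lra))) as [M HM].
  exists (M / (s * d)). intros n. unfold dcoef. rewrite Cmod_INR_mult.
  (* Bernoulli's inequality trades the factor n for a larger radius: 1 + n d <= (1 + d)^n and t (1 +
     d) <= t + d = s. *)
  assert (Hb : INR (S n) * t ^ n * d <= s ^ n).
  { assert (Hp : 1 + INR n * d <= (1 + d) ^ n) by (apply poly; lra).
    apply Rle_trans with (t ^ n * (1 + d) ^ n).
    - assert (0 <= t ^ n) by (apply pow_le; lra). rewrite S_INR.
      replace ((INR n + 1) * t ^ n * d) with (t ^ n * (INR n * d + d)) by ring.
      apply Rmult_le_compat_l; lra.
    - rewrite <- Rpow_mult_distr. apply pow_incr. unfold s. nra. }
  apply (Rmult_le_reg_r (s * d)); [nra|].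
  replace (M / (s * d) * (s * d)) with M by (field; lra).
  apply Rle_trans with (2 := HM (S n)). simpl pow.
  replace (INR (S n) * Cmod (a (S n)) * t ^ n * (s * d))
    with (Cmod (a (S n)) * (s * (INR (S n) * t ^ n * d))) by ring.
  apply Rmult_le_compat_l; [apply Cmod_ge_0|]. apply Rmult_le_compat_l; lra.
Qed.

Lemma Cpow_diff_le (w z : C) rho n : Cmod w <= rho -> Cmod z <= rho ->
  Cmod (w ^ S n - z ^ S n)%C <= Cmod (w - z)%C * (INR (S n) * rho ^ n).
Proof.
  intros Hw Hz. pose proof (Cmod_ge_0 z).
  induction n as [|n IH].
  - replace (w ^ 1 - z ^ 1)%C with (w - z)%C by (simpl; ring). simpl; lra.
  - replace (w ^ S (S n) - z ^ S (S n))%C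
      with (w * (w ^ S n - z ^ S n) + (w - z) * z ^ S n)%C by (simpl; ring).
    eapply Rle_trans; [apply Cmod_triangle|]. rewrite !Cmod_mult, Cmod_pow, (S_INR (S n)).
    assert (Cmod z ^ S n <= rho ^ S n) by (apply pow_incr; lra).
    assert (Cmod w * Cmod (w ^ S n - z ^ S n) <= rho * (Cmod (w - z) * (INR (S n) * rho ^ n))).
    { apply Rmult_le_compat; auto using Cmod_ge_0. }
    assert (Cmod (w - z) * Cmod z ^ S n <= Cmod (w - z) * rho ^ S n).
    { apply Rmult_le_compat_l; [apply Cmod_ge_0|easy]. }
    change (rho ^ S n) with (rho * rho ^ n) in *. nra.
Qed.

(** The factor [INR (S n) * INR (S (S n))] is twice the sharp one but is exactly the factor in
    [dcoef (dcoef a) n], so that summation yields the series of the second derivative. *)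
Lemma Cpow_taylor_le (w z : C) rho n : Cmod w <= rho -> Cmod z <= rho ->
  Cmod (w ^ S (S n) - z ^ S (S n) - (w - z) * (INR (S (S n)) * z ^ S n))%C
  <= Cmod (w - z)%C ^ 2 * (INR (S n) * INR (S (S n)) * rho ^ n).
Proof.
  intros Hw Hz. pose proof (Cmod_ge_0 z). assert (0 <= rho) by lra.
  induction n as [|n IH].
  - replace (w ^ 2 - z ^ 2 - (w - z) * (INR 2 * z ^ 1))%C with ((w - z) * (w - z))%C
      by (simpl; rewrite RtoC_plus; ring).
    rewrite Cmod_mult. simpl. pose proof (Cmod_ge_0 (w - z)). nra.
  - set (D := (w ^ S (S n) - z ^ S (S n) - (w - z) * (INR (S (S n)) * z ^ S n))%C) in *.
    replace (w ^ S (S (S n)) - z ^ S (S (S n)) - (w - z) * (INR (S (S (S n))) * z ^ S (S n)))%C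
      with (w * D + (w - z) * (w - z) * (INR (S (S n)) * z ^ S n))%C.
    2:{ unfold D. rewrite (S_INR (S (S n))), RtoC_plus.
        rewrite (Cpow_S w (S (S n))), (Cpow_S z (S (S n))), (Cpow_S z (S n)). ring. }
    eapply Rle_trans; [apply Cmod_triangle|].
    rewrite !Cmod_mult, Cmod_pow, Cmod_R, Rabs_pos_eq by apply pos_INR.
    set (e := Cmod (w - z)) in *. assert (0 <= e) by apply Cmod_ge_0.
    assert (Hzp : Cmod z ^ S n <= rho ^ S n) by (apply pow_incr; lra).
    assert (Hr : 0 <= rho ^ n) by now apply pow_le.
    assert (HA : Cmod w * Cmod D <= rho * (e ^ 2 * (INR (S n) * INR (S (S n)) * rho ^ n))).
    { apply Rmult_le_compat; auto using Cmod_ge_0. }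
    assert (HB : e * e * (INR (S (S n)) * Cmod z ^ S n) <= e * e * (INR (S (S n)) * rho ^ S n)).
    { apply Rmult_le_compat_l; [nra|]. apply Rmult_le_compat_l; [apply pos_INR|easy]. }
    eapply Rle_trans; [apply Rplus_le_compat; [exact HA|exact HB]|].
    change (rho ^ S n) with (rho * rho ^ n). rewrite (S_INR (S (S n))), (S_INR (S n)).
    pose proof (pos_INR (S n)). set (p := INR (S n)) in *.
    assert (0 <= e ^ 2 * (rho * rho ^ n)) by (apply Rmult_le_pos; nra).
    nra.
Qed.

Lemma has_psum_lipschitz (a : nat -> C) (w z lw lz : C) rho s :
  Cmod w <= rho -> Cmod z <= rho -> has_psum a w lw -> has_psum a z lz ->
  is_series (fun n => Cmod (dcoef a n) * rho ^ n) s ->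
  Cmod (lw - lz) <= s * Cmod (w - z).
Proof.
  intros Hw Hz Hlw Hlz Hs.
  assert (Hr : 0 <= rho) by (eapply Rle_trans; [apply Cmod_ge_0|exact Hw]).
  assert (Hn : forall n, Cmod (csum (fun k => a k * w ^ k)%C n - csum (fun k => a k * z ^ k)%C n)
                         <= s * Cmod (w - z)).
  { assert (Hpos : forall n, 0 <= Cmod (dcoef a n) * rho ^ n).
    { intros n. apply Rmult_le_pos; [apply Cmod_ge_0|now apply pow_le]. }
    assert (HS : forall n, Cmod (csum (fun k => a k * w ^ k)%C (S n)
                         - csum (fun k => a k * z ^ k)%C (S n)) <= s * Cmod (w - z)).
    { intros n. rewrite !csum_shift.
      replace (a 0%nat * w ^ 0 + csum (fun i => a (S i) * w ^ S i) n -
        (a 0%nat * z ^ 0 + csum (fun i => a (S i) * z ^ S i) n))%C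
        with (csum (fun i => a (S i) * (w ^ S i - z ^ S i)) n)%C.
      2:{ rewrite (csum_ext _ (fun i => a (S i) * w ^ S i - a (S i) * z ^ S i)%C)
            by (intros; ring). rewrite csum_minus. simpl; ring. }
      eapply Rle_trans; [apply Cmod_csum_le|].
      apply Rle_trans with (sum_f_R0 (fun i => Cmod (dcoef a i) * rho ^ i * Cmod (w - z)) n).
      - apply sum_Rle. intros i _. unfold dcoef. rewrite Cmod_INR_mult, Cmod_mult.
        pose proof (Cpow_diff_le w z rho i Hw Hz). pose proof (Cmod_ge_0 (a (S i))). nra.
      - rewrite <- scal_sum, Rmult_comm. apply Rmult_le_compat_r; [apply Cmod_ge_0|].
        now apply sum_f_R0_le_is_series. }
    intros [|n]; [|apply HS]. cbn [csum].
    replace (a 0%nat * w ^ 0 - a 0%nat * z ^ 0)%C with (RtoC 0) by (simpl; ring).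
    rewrite Cmod_0. apply Rmult_le_pos; [|apply Cmod_ge_0].
    eapply Rle_trans; [apply (Hpos 0%nat)|].
    exact (sum_f_R0_le_is_series (fun n => Cmod (dcoef a n) * rho ^ n) 0 s Hpos Hs). }
  pose proof (is_lim_seq_plus' _ _ _ _ (is_lim_seq_const (s * Cmod (w - z)))
               (is_lim_seq_plus' _ _ _ _ Hlw Hlz)) as Hlim.
  rewrite !Rplus_0_r in Hlim. apply is_lim_seq_lower_bound with (2 := Hlim).
  intros n. specialize (Hn n). set (x := csum (fun k => a k * w ^ k)%C n) in *.
  set (y := csum (fun k => a k * z ^ k)%C n) in *.
  replace (lw - lz)%C with (x - y + (- (x - lw) + (y - lz)))%C by ring.
  eapply Rle_trans; [apply Cmod_triangle|]. apply Rplus_le_compat; [exact Hn|].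
  eapply Rle_trans; [apply Cmod_triangle|]. rewrite Cmod_opp. lra.
Qed.

Lemma has_psum_taylor (a : nat -> C) (w z lw lz dz : C) rho s :
  Cmod w <= rho -> Cmod z <= rho -> has_psum a w lw -> has_psum a z lz -> has_psum (dcoef a) z dz ->
  is_series (fun n => Cmod (dcoef (dcoef a) n) * rho ^ n) s ->
  Cmod (lw - lz - (w - z) * dz) <= s * Cmod (w - z) ^ 2.
Proof.
  intros Hw Hz Hlw Hlz Hdz Hs.
  assert (Hr : 0 <= rho) by (eapply Rle_trans; [apply Cmod_ge_0|exact Hw]).
  assert (Hpos : forall n, 0 <= Cmod (dcoef (dcoef a) n) * rho ^ n).
  { intros n. apply Rmult_le_pos; [apply Cmod_ge_0|now apply pow_le]. }
  assert (HS : forall n, Cmod (csum (fun k => a k * w ^ k)%C (S (S n))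
                 - csum (fun k => a k * z ^ k)%C (S (S n))
                 - (w - z) * csum (fun k => dcoef a k * z ^ k) (S n))%C <= s * Cmod (w - z) ^ 2).
  { intros n. rewrite !(csum_shift _ (S n)), !(csum_shift _ n).
    match goal with |- Cmod ?e <= _ => replace e with
      (csum (fun i => a (S (S i)) * (w ^ S (S i) - z ^ S (S i)
               - (w - z) * (INR (S (S i)) * z ^ S i))) n)%C end.
    2:{ rewrite (csum_ext _ (fun i => a (S (S i)) * w ^ S (S i) - a (S (S i)) * z ^ S (S i)
                  - (w - z) * (dcoef a (S i) * z ^ S i))%C)
          by (intros; unfold dcoef; ring).
        rewrite !csum_minus, csum_mult_l. unfold dcoef at 2. simpl. ring. }
    eapply Rle_trans; [apply Cmod_csum_le|].
    apply Rle_trans with (sum_f_R0 (fun i => Cmod (dcoef (dcoef a) i) * rho ^ i * Cmod (w - z) ^ 2) n).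
    - apply sum_Rle. intros i _. unfold dcoef. rewrite !Cmod_INR_mult, Cmod_mult.
      pose proof (Cpow_taylor_le w z rho i Hw Hz) as H.
      apply (Rmult_le_compat_l (Cmod (a (S (S i))))) in H; [|apply Cmod_ge_0].
      eapply Rle_trans; [exact H|]. apply Req_le; ring.
    - rewrite <- scal_sum, Rmult_comm. apply Rmult_le_compat_r; [apply pow2_ge_0|].
      now apply sum_f_R0_le_is_series. }
  apply (is_lim_seq_incr_n _ 2) in Hlw. apply (is_lim_seq_incr_n _ 2) in Hlz.
  apply (is_lim_seq_incr_n _ 1) in Hdz.
  pose proof (is_lim_seq_plus' _ _ _ _ (is_lim_seq_const (s * Cmod (w - z) ^ 2))
               (is_lim_seq_plus' _ _ _ _ Hlw (is_lim_seq_plus' _ _ _ _ Hlz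
                 (is_lim_seq_mult' _ _ _ _ (is_lim_seq_const (Cmod (w - z))) Hdz)))) as Hlim.
  rewrite Rmult_0_r, !Rplus_0_r in Hlim. apply is_lim_seq_lower_bound with (2 := Hlim).
  intros n. specialize (HS n).
  replace (n + 2)%nat with (S (S n)) by lia. replace (n + 1)%nat with (S n) by lia.
  set (x := csum (fun k => a k * w ^ k)%C (S (S n))) in *.
  set (y := csum (fun k => a k * z ^ k)%C (S (S n))) in *.
  set (d := csum (fun k => dcoef a k * z ^ k)%C (S n)) in *.
  replace (lw - lz - (w - z) * dz)%C
    with (x - y - (w - z) * d + (- (x - lw) + (y - lz + (w - z) * (d - dz))))%C by ring.
  eapply Rle_trans; [apply Cmod_triangle|]. apply Rplus_le_compat; [exact HS|].
  eapply Rle_trans; [apply Cmod_triangle|]. rewrite Cmod_opp. apply Rplus_le_compat_l.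
  eapply Rle_trans; [apply Cmod_triangle|]. rewrite Cmod_mult. lra.
Qed.

Lemma is_C_derive_quadratic (F : C -> C) (z l : C) (M d : R) : 0 < d ->
  (forall w, Cmod (w - z) < d -> Cmod (F w - F z - (w - z) * l) <= M * Cmod (w - z) ^ 2) ->
  @is_derive C_AbsRing C_NormedModule F z l.
Proof.
  intros Hd H. split.
  - apply is_linear_scal_l.
  - intros x Hx. pose proof (@is_filter_lim_locally_unique C_AbsRing (AbsRing_NormedModule C_AbsRing) z x Hx) as E.
    subst x.
    intros eps. set (d' := Rmin d (eps / (Rabs M + 1))).
    assert (HM : 0 < Rabs M + 1) by (pose proof (Rabs_pos M); lra).
    assert (Hd' : 0 < d').
    { apply Rmin_glb_lt; [easy|]. apply Rdiv_lt_0_compat; [apply cond_pos|easy]. }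
    exists (mkposreal d' Hd'). intros w Hw. change (Cmod (w - z) < d') in Hw.
    change (Cmod (F w - F z - (w - z) * l)%C <= eps * Cmod (w - z)%C).
    assert (H1 : Cmod (w - z) < d) by (eapply Rlt_le_trans; [exact Hw|apply Rmin_l]).
    assert (H2 : Cmod (w - z) < eps / (Rabs M + 1))
      by (eapply Rlt_le_trans; [exact Hw|apply Rmin_r]).
    eapply Rle_trans; [now apply H|].
    pose proof (Cmod_ge_0 (w - z)). set (e := Cmod (w - z)) in *.
    assert (e * (Rabs M + 1) <= eps).
    { apply (Rmult_lt_compat_r (Rabs M + 1)) in H2; [|easy].
      unfold Rdiv in H2. rewrite Rmult_assoc, Rinv_l in H2 by lra. lra. }
    pose proof (Rle_abs M). simpl. nra.
Qed.

Lemma has_psum_is_derive (a : nat -> C) (F : C -> C) z dz : disk_conv a ->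
  (forall z, Cmod z < 1 -> has_psum a z (F z)) -> Cmod z < 1 -> has_psum (dcoef a) z dz ->
  @is_derive C_AbsRing C_NormedModule F z dz.
Proof.
  intros Ha HF Hz Hdz. set (rho := (1 + Cmod z) / 2).
  pose proof (Cmod_ge_0 z) as H0.
  destruct (disk_conv_dcoef _ (disk_conv_dcoef a Ha) rho) as [s Hs]; [unfold rho; lra|].
  apply (is_C_derive_quadratic F z dz s (rho - Cmod z)); [unfold rho; lra|].
  intros w Hw. assert (Hw' : Cmod w <= rho).
  { replace w with (w - z + z)%C by ring. eapply Rle_trans; [apply Cmod_triangle|lra]. }
  apply (has_psum_taylor a w z _ _ dz rho s); auto.
  - unfold rho; lra.
  - apply HF. unfold rho in Hw'. lra.
Qed.

(** * Reciprocals of power series *)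

(** Each coefficient of the reciprocal depends on all earlier ones. Stage N returns a function that
    is right up to index N, which makes this recursion structural. *)
Fixpoint inverse_upto (H : nat -> C) (N : nat) : nat -> C :=
  match N with
  | O => fun _ => (/ H 0%nat)%C
  | S m => fun n => if le_dec n m then inverse_upto H m n
                    else (- / H 0%nat * csum (fun i => H (S i) * inverse_upto H m (m - i)%nat) m)%C
  end.

Definition formal_inverse (H : nat -> C) (n : nat) : C := inverse_upto H n n.

Lemma inverse_upto_stable (H : nat -> C) N n :
  (n <= N)%nat -> inverse_upto H N n = formal_inverse H n.
Proof.
  induction 1 as [|N HN IH]; [easy|]. simpl. destruct (le_dec n N); [easy|lia].
Qed.

Lemma formal_inverse_correct (H : nat -> C) n :
  H 0%nat <> 0%C -> conv H (formal_inverse H) n = cone n.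
Proof.
  intros H0. destruct n as [|m].
  - unfold conv, formal_inverse; simpl. field; exact H0.
  - unfold conv. rewrite csum_shift, Nat.sub_0_r. unfold formal_inverse at 1. simpl.
    destruct (le_dec (S m) m); [lia|].
    rewrite (csum_ext (fun i => H (S i) * inverse_upto H m (m - i)%nat)%C
               (fun i => H (S i) * formal_inverse H (m - i)%nat)%C)
      by (intros; rewrite inverse_upto_stable by lia; reflexivity).
    field; exact H0.
Qed.

Lemma C_inv_unique (x y : C) : (x * y)%C = 1%C -> x = (/ y)%C.
Proof.
  intros E. assert (Hy : y <> 0%C).
  { intros E0. rewrite E0, Cmult_0_r in E. apply RtoC_inj in E. lra. }
  transitivity (x * y * / y)%C; [field; exact Hy|]. rewrite E. ring.
Qed.

(** Compactness of the square around the disk. The gauge at a centre c serves both as the size of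
    its neighbourhood and as a lower bound for |F| there, so the uniform d provided by compactness
    bounds |F| from below. *)
Lemma nonvanishing_lower_bound (F : C -> C) (a : nat -> C) (rho : R) :
  disk_conv a -> (forall z, Cmod z < 1 -> has_psum a z (F z)) ->
  (forall z, Cmod z < 1 -> F z <> 0%C) -> 0 <= rho < 1 ->
  exists m, 0 < m /\ forall z, Cmod z <= rho -> m <= Cmod (F z).
Proof.
  intros Ha HF Hnz Hr.
  assert (Hloc : forall u v : R, exists d : posreal, forall z : C, Cmod z <= rho ->
     Rabs (fst z - u) < d -> Rabs (snd z - v) < d -> d <= Cmod (F z)).
  { intros u v. set (c := (u, v) : C).
    assert (Hdist : forall (d : R) (z : C), Rabs (fst z - u) < d -> Rabs (snd z - v) < d ->
                      Cmod (z - c) < 2 * d).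
    { intros d z Hre Him. replace (z - c)%C with (RtoC (fst z - u) + Ci * RtoC (snd z - v))%C
        by (apply injective_projections; simpl; ring).
      eapply Rle_lt_trans; [apply Cmod_triangle|].
      rewrite Cmod_mult, Cmod_Ci, !Cmod_R. lra. }
    destruct (Rlt_le_dec (Cmod c) 1) as [Hc|Hc].
    - set (r := (1 + Rmax rho (Cmod c)) / 2).
      pose proof (Rmax_l rho (Cmod c)). pose proof (Rmax_r rho (Cmod c)).
      assert (Rmax rho (Cmod c) < 1) by (apply Rmax_lub_lt; lra).
      destruct (disk_conv_dcoef a Ha r) as [s Hs]; [unfold r; lra|].
      assert (Hs0 : 0 <= s).
      { apply Rle_trans with (sum_f_R0 (fun n => Cmod (dcoef a n) * r ^ n) 0).
        - simpl. pose proof (Cmod_ge_0 (dcoef a 0)). lra.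
        - apply sum_f_R0_le_is_series; [|exact Hs]. intros n.
          apply Rmult_le_pos; [apply Cmod_ge_0|apply pow_le; unfold r; lra]. }
      assert (HFc : 0 < Cmod (F c)) by (apply Cmod_gt_0, Hnz, Hc).
      (* This d solves d + 2 s d = |F c|: within distance 2 d of c the Lipschitz constant s leaves
         at least d. *)
      assert (Hd : 0 < Cmod (F c) / (1 + 2 * s)) by (apply Rdiv_lt_0_compat; lra).
      exists (mkposreal _ Hd). simpl. intros z Hz Hre Him.
      pose proof (Hdist _ z Hre Him) as Hzc.
      assert (HL : Cmod (F z - F c) <= s * Cmod (z - c)).
      { apply (has_psum_lipschitz a z c _ _ r); auto; try (unfold r; lra).
        - apply HF. lra. }
      set (d := Cmod (F c) / (1 + 2 * s)) in *.
      assert (E : Cmod (F c) = d + 2 * s * d) by (unfold d; field; lra).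
      assert (Cmod (F c) <= Cmod (F z) + Cmod (F z - F c)).
      { rewrite <- (Cmod_opp (F z - F c)).
        replace (F c) with (F z + - (F z - F c))%C at 1 by ring. apply Cmod_triangle. }
      nra.
    (* A centre with |c| >= 1 lies in the square but not in the open disk; this size makes its
       neighbourhood miss all z with |z| <= rho. *)
    - assert (Hd : 0 < (1 - rho) / 2) by lra.
      exists (mkposreal _ Hd). simpl. intros z Hz Hre Him.
      pose proof (Hdist _ z Hre Him) as Hzc. exfalso.
      assert (Cmod c <= Cmod z + Cmod (z - c)).
      { rewrite <- (Cmod_opp (z - c)).
        replace c with (z + - (z - c))%C at 1 by ring. apply Cmod_triangle. }
      lra. }
  set (delta := fun u v => proj1_sig (constructive_indefinite_description _ (Hloc u v))).
  destruct (compactness_value_2d (-1) 1 (-1) 1 delta) as [d Hd].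
  exists d. split; [apply cond_pos|]. intros z Hz.
  assert (Hz' : Rmax (Rabs (fst z)) (Rabs (snd z)) <= 1).
  { eapply Rle_trans; [apply Rmax_Cmod|lra]. }
  pose proof (Rmax_l (Rabs (fst z)) (Rabs (snd z))).
  pose proof (Rmax_r (Rabs (fst z)) (Rabs (snd z))).
  apply Rnot_lt_le. intros Hlt.
  apply (Hd (fst z) (snd z)); [apply Rabs_le_between; lra|apply Rabs_le_between; lra|].
  intros (u & v & _ & _ & Hre & Him & Hle).
  unfold delta in *. destruct (constructive_indefinite_description _ (Hloc u v)) as [e He].
  simpl in *. pose proof (He z Hz Hre Him). lra.
Qed.

Section Inverse.
Variables (H c : nat -> C) (F : C -> C).
Hypotheses (HH : disk_conv H) (HF : forall z, Cmod z < 1 -> has_psum H z (F z))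
  (Hc : forall n, conv c H n = cone n).

Lemma has_psum_cone z : has_psum cone z 1%C.
Proof.
  replace (RtoC 1) with (csum (fun k => cone k * z ^ k)%C 0) by (simpl; ring).
  apply has_psum_polynomial. intros [|i] Hi; [lia|easy].
Qed.

(** Rescaling by t keeps every evaluation inside the unit disk while c is known to converge only up
    to radius t. *)
Lemma has_psum_inverse_value (z l : C) (t : R) : disk_conv (fun n => c n * t ^ n)%C ->
  0 <= t < 1 -> Cmod z < 1 -> has_psum (fun n => c n * t ^ n)%C z l ->
  (l * F (t * z) = 1)%C.
Proof.
  intros Hct Ht Hz Hl.
  assert (Htz : Cmod (t * z) < 1).
  { rewrite Cmod_mult, Cmod_R, Rabs_pos_eq by lra. pose proof (Cmod_ge_0 z). nra. }
  assert (HP : has_psum (fun k => H k * t ^ k)%C z (F (t * z)%C)) by (apply has_psum_scale; auto).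
  apply (has_psum_unique cone z); [|apply has_psum_cone].
  assert (Hdt : disk_conv (fun k => H k * t ^ k)%C) by (apply disk_conv_scale; [lra|easy]).
  pose proof (has_psum_conv _ _ z _ _ Hct Hdt Hz Hl HP) as HC.
  revert HC. apply is_lim_seq_ext. intros n. do 2 f_equal. apply csum_ext. intros i _. f_equal.
  rewrite conv_scale, Hc. destruct i; simpl; ring.
Qed.

(* With [c' = c t'^n], [c_t = c t^n] and [E = H t'^n - H t^n], the formal identity
   [c' = c_t * (1 - E * c')] bounds [c'] in l2 as soon as the multipliers [c_t] and [E]
   (of norms [B] and [(t' - t) L]) satisfy [B (t' - t) L <= 1/2]; the resulting bound
   does not deteriorate from one step to the next. *)
Lemma inverse_bound_step (B L t t' : R) :
  0 <= t <= t' -> t' < 1 ->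
  (forall z, Cmod z <= t' -> 1 <= B * Cmod (F z)) ->
  (forall w z, Cmod w <= t' -> Cmod z <= t' -> Cmod (F w - F z) <= L * Cmod (w - z)) ->
  B * ((t' - t) * L) <= / 2 ->
  (exists M, forall n, Cmod (c n) * t ^ n <= M) ->
  forall n, Cmod (c n) * t' ^ n <= 2 * B.
Proof.
  intros Ht Ht' HB HL Hstep [M HM] n.
  set (ct := fun k => (c k * t ^ k)%C). set (c' := fun k => (c k * t' ^ k)%C).
  set (Hct_t := fun k => (H k * t ^ k)%C). set (H' := fun k => (H k * t' ^ k)%C).
  set (E := fun k => (H' k - Hct_t k)%C).
  assert (HmodR : forall (x : R) (z : C), 0 <= x -> Cmod (x * z) = x * Cmod z).
  { intros x z Hx. now rewrite Cmod_mult, Cmod_R, Rabs_pos_eq. }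
  assert (HB0 : 0 <= B).
  { assert (H0 : 1 <= B * Cmod (F 0%C)) by (apply HB; rewrite Cmod_0; lra).
    pose proof (Cmod_ge_0 (F 0%C)). nra. }
  assert (Hct : disk_conv ct).
  { apply disk_conv_bounded. intros r Hr. exists M. intros k. unfold ct.
    rewrite Cmod_term, Cmod_R, Rabs_pos_eq by lra.
    assert (0 <= Cmod (c k) * t ^ k)
      by (apply Rmult_le_pos; [apply Cmod_ge_0|apply pow_le; lra]).
    assert (0 <= r ^ k <= 1).
    { split; [apply pow_le; lra|]. rewrite <- (pow1 k). apply pow_incr; lra. }
    specialize (HM k). nra. }
  assert (HdE : disk_conv E).
  { apply disk_conv_minus; apply disk_conv_scale; auto; lra. }
  assert (Htz : forall (x : R) z, 0 <= x <= t' -> Cmod z < 1 -> Cmod (x * z) <= t').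
  { intros x z Hx Hz. rewrite HmodR by lra. pose proof (Cmod_ge_0 z). nra. }
  assert (HL0 : 0 <= (t' - t) * L).
  { destruct (Req_dec t t') as [->|Hne]; [lra|].
    assert (Hl : 0 <= L * Cmod (RtoC t' - RtoC t)).
    { eapply Rle_trans; [apply Cmod_ge_0|]. apply (HL t' t); rewrite Cmod_R, Rabs_pos_eq; lra. }
    rewrite <- RtoC_minus, Cmod_R, Rabs_pos_eq in Hl by lra. nra. }
  assert (HevE : forall z, Cmod z < 1 -> has_psum E z (F (t' * z)%C - F (t * z)%C)%C).
  { intros z Hz. apply (has_psum_minus H' Hct_t); apply has_psum_scale; apply HF;
      eapply Rle_lt_trans; try apply Htz; auto; lra. }
  assert (HbE : forall z, Cmod z < 1 -> Cmod (F (t' * z)%C - F (t * z)%C) <= (t' - t) * L).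
  { intros z Hz. eapply Rle_trans; [apply HL; apply Htz; auto; lra|].
    replace (t' * z - t * z)%C with (RtoC (t' - t) * z)%C by (rewrite RtoC_minus; ring).
    rewrite HmodR by lra. pose proof (Cmod_ge_0 z). nra. }
  assert (Hevc : forall z, Cmod z < 1 -> has_psum ct z (/ F (t * z)%C)%C /\ Cmod (/ F (t * z)%C)%C <= B).
  { intros z Hz. destruct (has_psum_ex ct z Hct Hz) as [l Hl].
    assert (Hlv : (l * F (t * z) = 1)%C) by (apply (has_psum_inverse_value z l t); auto; lra).
    rewrite <- (C_inv_unique _ _ Hlv).
    split; [exact Hl|].
    assert (H1 : Cmod l * Cmod (F (t * z)%C) = 1) by (rewrite <- Cmod_mult, Hlv; apply Cmod_1).
    assert (H2 : 1 <= B * Cmod (F (t * z)%C)) by (apply HB, Htz; [lra|easy]).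
    pose proof (Cmod_ge_0 l). nra. }
  assert (Hq : forall k, conv Hct_t c' k = (cone k - conv E c' k)%C).
  { intros k. assert (HH' : conv H' c' k = cone k).
    { unfold H', c'. rewrite conv_scale, conv_comm, Hc. destruct k; simpl; ring. }
    rewrite <- HH'. unfold conv. rewrite <- csum_minus. apply csum_ext. intros i _.
    unfold E. ring. }
  assert (Hcc : forall k, conv ct (conv Hct_t c') k = c' k).
  { intros k. rewrite <- conv_assoc, <- (conv_cone_l c' k). apply conv_ext; [|easy].
    intros i _. unfold ct, Hct_t. rewrite conv_scale, Hc. destruct i; simpl; ring. }
  set (X := sum_f_R0 (fun k => Cmod (c' k) ^ 2) n).
  set (e := (t' - t) * L) in *.
  (* From (x + y)^2 <= 2 x^2 + 2 y^2. As (B e)^2 <= 1/4, the last term is at most X / 2 and is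
     absorbed: X <= 4 B^2, whence the bound 2 B. *)
  assert (HX : X <= B ^ 2 * (2 + 2 * (e ^ 2 * X))).
  { unfold X at 1. rewrite (sum_eq _ (fun k => Cmod (conv ct (conv Hct_t c') k) ^ 2))
      by (intros; now rewrite Hcc).
    eapply Rle_trans.
    - apply (conv_l2_le ct (fun z => / F (t * z))%C B); auto; apply Hevc.
    - apply Rmult_le_compat_l; [nra|].
      apply Rle_trans with (sum_f_R0 (fun k => Cmod (cone k) ^ 2 * 2 + Cmod (conv E c' k) ^ 2 * 2) n).
      + apply sum_Rle. intros k _. rewrite Hq.
        assert (Cmod (cone k - conv E c' k) <= Cmod (cone k) + Cmod (conv E c' k)).
        { rewrite <- (Cmod_opp (conv E c' k)). apply Cmod_triangle. }
        pose proof (Cmod_ge_0 (cone k - conv E c' k)).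
        pose proof (pow2_ge_0 (Cmod (cone k) - Cmod (conv E c' k))). nra.
      + rewrite sum_plus, <- !scal_sum.
        rewrite (sum_f_R0_eventually_zero (fun k => Cmod (cone k) ^ 2) 0 n); [|lia|].
        2:{ intros [|i] Hi; [lia|]. simpl cone. rewrite Cmod_0. ring. }
        cbn [sum_f_R0 cone]. rewrite Cmod_1.
        pose proof (conv_l2_le E _ e c' n HdE HevE HbE). fold X in H0. lra. }
  assert (HcX : Cmod (c' n) ^ 2 <= X).
  { unfold X. destruct n as [|m]; cbn [sum_f_R0]; [lra|].
    pose proof (cond_pos_sum (fun k => Cmod (c' k) ^ 2) m (fun k => pow2_ge_0 _)). lra. }
  assert (Hmod : Cmod (c' n) = Cmod (c n) * t' ^ n).
  { unfold c'. rewrite Cmod_term, Cmod_R, Rabs_pos_eq by lra. reflexivity. }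
  rewrite <- Hmod. pose proof (Cmod_ge_0 (c' n)).
  assert (HBe : 0 <= B * e) by (apply Rmult_le_pos; easy).
  assert (HBe2 : (B * e) ^ 2 <= / 4) by nra.
  assert (HX0 : 0 <= X) by nra.
  assert (X <= 2 * B ^ 2 + 2 * ((B * e) ^ 2 * X)) by nra.
  assert ((B * e) ^ 2 * X <= / 4 * X) by (apply Rmult_le_compat_r; easy).
  assert (X <= 4 * B ^ 2) by lra.
  nra.
Qed.

(** The bound B for 1/|F| and the Lipschitz constant L hold on the whole disk of radius rho, so one
    step length serves all the way. The walk starts at radius 0, where the terms are trivially
    bounded, and reaches rho after finitely many equal steps. *)
Lemma disk_conv_inverse : (forall z, Cmod z < 1 -> F z <> 0%C) -> disk_conv c.
Proof.
  intros Hnz. apply disk_conv_bounded. intros rho Hr.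
  destruct (nonvanishing_lower_bound F H rho HH HF Hnz Hr) as (m & Hm & HmF).
  destruct (disk_conv_dcoef H HH rho Hr) as [L HL].
  set (B := / m). assert (HB : 0 < B) by now apply Rinv_0_lt_compat.
  assert (HBF : forall z, Cmod z <= rho -> 1 <= B * Cmod (F z)).
  { intros z Hz. specialize (HmF z Hz). apply (Rmult_le_compat_l B) in HmF; [|lra].
    unfold B in *. rewrite Rinv_l in HmF by lra. exact HmF. }
  assert (HLip : forall w z, Cmod w <= rho -> Cmod z <= rho ->
                   Cmod (F w - F z) <= L * Cmod (w - z)).
  { intros w z Hw Hz. apply (has_psum_lipschitz H w z _ _ rho); auto; apply HF; lra. }
  (* With N + 1 steps of length rho / (N + 1), this gives B L rho / (N + 1) <= 1/2, as
     [inverse_bound_step] requires. *)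
  destruct (INR_unbounded (2 * B * rho * L)) as [N HN].
  assert (HN1 : 0 < INR (S N)) by (apply lt_0_INR; lia).
  assert (Hk : forall k, (k <= S N)%nat ->
     exists M, forall n, Cmod (c n) * (INR k * (rho / INR (S N))) ^ n <= M).
  { set (d := rho / INR (S N)).
    assert (Hd : 0 <= d) by (apply Rmult_le_pos; [lra|left; now apply Rinv_0_lt_compat]).
    assert (HdN : INR (S N) * d = rho) by (unfold d; field; lra).
    induction k as [|k IH]; intros HkN.
    - exists (Cmod (c 0%nat)). intros n. simpl INR. rewrite Rmult_0_l.
      destruct n as [|n]; simpl; [lra|]. pose proof (Cmod_ge_0 (c 0%nat)). lra.
    - exists (2 * B).
      assert (Hle : INR (S k) * d <= rho).
      { rewrite <- HdN. apply Rmult_le_compat_r; [easy|]. now apply le_INR. }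
      pose proof (pos_INR k). rewrite S_INR in *.
      apply (inverse_bound_step B L (INR k * d) ((INR k + 1) * d)).
      + split; nra.
      + lra.
      + intros z Hz; apply HBF; lra.
      + intros w z Hw Hz; apply HLip; lra.
      + replace ((INR k + 1) * d - INR k * d) with d by ring.
        apply (Rmult_le_reg_l (INR (S N))); [rewrite S_INR; lra|].
        rewrite S_INR in *.
        replace ((INR N + 1) * (B * (d * L))) with (B * ((INR N + 1) * d) * L) by ring.
        rewrite HdN. lra.
      + apply IH; lia. }
  destruct (Hk (S N) (le_n _)) as [M HM]. exists M. intros n.
  specialize (HM n). replace (INR (S N) * (rho / INR (S N))) with rho in HM by (field; lra).
  exact HM.
Qed.
End Inverse.

(* Rogosinski's inequality for [G = omega F] with [|omega| <= k]; the quotient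
   [omega] is a power series on the disk because [F] does not vanish. *)
Lemma dominated_partial_l2 (H G : nat -> C) (F1 F2 : C -> C) (k : R) (N : nat) :
  disk_conv H -> disk_conv G ->
  (forall z, Cmod z < 1 -> has_psum H z (F1 z)) -> (forall z, Cmod z < 1 -> has_psum G z (F2 z)) ->
  (forall z, Cmod z < 1 -> F1 z <> 0%C) ->
  (forall z, Cmod z < 1 -> Cmod (F2 z / F1 z)%C <= k) ->
  sum_f_R0 (fun n => Cmod (G n) ^ 2) N <= k ^ 2 * sum_f_R0 (fun n => Cmod (H n) ^ 2) N.
Proof.
  intros HH HG HF1 HF2 Hnz Hk.
  assert (H0 : H 0%nat <> 0%C).
  { intros E. apply (Hnz 0%C); [rewrite Cmod_0; lra|].
    apply (has_psum_unique H 0%C); [apply HF1; rewrite Cmod_0; lra|].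
    unfold has_psum. apply is_lim_seq_eventually_const with 0%nat. intros n _.
    rewrite csum_zero.
    - replace (0 - 0)%C with (RtoC 0) by ring. apply Cmod_0.
    - intros [|i] _; [rewrite E; ring|]. rewrite Cpow_S. ring. }
  set (c := formal_inverse H).
  assert (Hc : forall n, conv c H n = cone n).
  { intros n. rewrite conv_comm. now apply formal_inverse_correct. }
  assert (Hdc : disk_conv c) by (apply (disk_conv_inverse H c F1); auto).
  rewrite (sum_eq _ (fun n => Cmod (conv (conv G c) H n) ^ 2)).
  2:{ intros n _. do 2 f_equal. rewrite conv_assoc, conv_comm.
      rewrite (conv_ext _ cone G G) by auto. now rewrite conv_cone_l. }
  apply (conv_l2_le (conv G c) (fun z => F2 z / F1 z)%C).
  - now apply disk_conv_conv.
  - intros z Hz. apply has_psum_conv; auto.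
    destruct (has_psum_ex c z Hdc Hz) as [l Hl].
    assert (Hlv : (l * F1 z = 1)%C).
    { apply (has_psum_unique cone z); [|apply has_psum_cone].
      pose proof (has_psum_conv c H z l (F1 z) Hdc HH Hz Hl (HF1 z Hz)) as HC.
      revert HC. apply is_lim_seq_ext. intros n. do 2 f_equal. apply csum_ext.
      intros i _. now rewrite Hc. }
    now rewrite <- (C_inv_unique _ _ Hlv).
  - exact Hk.
Qed.

(** * The inequality *)

(** Summation by parts. The induction has to carry the boundary term, [w N] times the gap between
    the partial sums; it is non-negative and is dropped at the end. *)
Lemma abel_sum_le (X Y w : nat -> R) :
  (forall N, sum_f_R0 Y N <= sum_f_R0 X N) ->
  (forall n, 0 <= w n) -> (forall n, w (S n) <= w n) ->
  forall N, sum_f_R0 (fun n => Y n * w n) N <= sum_f_R0 (fun n => X n * w n) N.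
Proof.
  intros HXY Hw Hdec.
  assert (H : forall N, w N * (sum_f_R0 X N - sum_f_R0 Y N)
     <= sum_f_R0 (fun n => X n * w n) N - sum_f_R0 (fun n => Y n * w n) N).
  { induction N as [|N IH]; cbn [sum_f_R0]; [lra|].
    specialize (HXY N). specialize (Hdec N). nra. }
  intros N. specialize (H N). specialize (HXY N). specialize (Hw N). nra.
Qed.

Lemma weighted_cauchy_schwarz (B P : nat -> R) (e s : R) : 0 <= e -> 0 <= s ->
  (forall n, 0 <= P n) ->
  (forall N, sum_f_R0 P N <= s) ->
  (forall N, sum_f_R0 (fun n => B n ^ 2 * P n) N <= e ^ 2 * s) ->
  forall N, sum_f_R0 (fun n => B n * P n) N <= e * s.
Proof.
  intros He Hs HP HPs HBs N. apply Rnot_lt_le. intros Hlt.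
  set (x := sum_f_R0 _ N) in *.
  (* Dividing by s + 1 covers s = 0 and keeps (e + d) s strictly below x, which is what the constant
     c = e + d will contradict. *)
  set (d := (x - e * s) / (s + 1)).
  assert (Hd : 0 < d) by (apply Rdiv_lt_0_compat; lra).
  assert (Hds : d * s < x - e * s).
  { replace (x - e * s) with (d * (s + 1)) by (unfold d; field; lra). lra. }
  set (c := e + d).
  (* AM-GM: [2 c B <= B^2 + c^2], with [c > e] because [e] may be 0 *)
  assert (Hx : 2 * c * x <= e ^ 2 * s + c ^ 2 * s).
  { eapply Rle_trans; [|apply Rplus_le_compat;
      [apply (HBs N)|apply Rmult_le_compat_l; [apply pow2_ge_0|apply (HPs N)]]].
    unfold x. rewrite !scal_sum, <- sum_plus. apply sum_Rle. intros n _.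
    pose proof (pow2_ge_0 (B n - c)). specialize (HP n). nra. }
  assert (e ^ 2 * s <= c ^ 2 * s).
  { apply Rmult_le_compat_r; [easy|]. unfold c; nra. }
  assert (c * x <= c * (c * s)) by nra.
  assert (x <= c * s) by (apply (Rmult_le_reg_l c); unfold c in *; lra).
  unfold c in *. lra.
Qed.

(** * Carlson's bounds summed against the weights *)

Lemma is_series_single (x : nat -> R) k :
  is_series (fun m => if Nat.eq_dec m k then x m else 0) (x k).
Proof.
  apply is_series_sum_f_R0. apply is_lim_seq_eventually_const with k. intros n Hn.
  apply RtoC_inj. rewrite <- csum_RtoC, (csum_single _ k); [|easy|].
  - now destruct (Nat.eq_dec k k).
  - intros i _ Hi. now destruct (Nat.eq_dec i k).
Qed.

Lemma is_series_shifted (x : nat -> R) (k : nat) (s : R) : (0 < k)%nat ->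
  is_series (fun i => x (k + i)%nat) s ->
  is_series (fun m => if le_dec k m then x m else 0) s.
Proof.
  intros Hk Hs. apply is_series_decr_n with k; [easy|].
  replace (sum_n _ (Init.Nat.pred k)) with 0.
  - change (plus s (opp 0)) with (s + - 0). rewrite Ropp_0, Rplus_0_r.
    apply is_series_ext with (2 := Hs). intros n. destruct (le_dec k (k + n)); [easy|lia].
  - rewrite sum_n_Reals. symmetry. rewrite (sum_eq _ (fun _ => 0)).
    + rewrite sum_cte; ring.
    + intros i Hi. destruct (le_dec k i); [lia|easy].
Qed.

Lemma is_series_finite_sum (u : nat -> nat -> R) (s : nat -> R) J :
  (forall j, is_series (u j) (s j)) ->
  is_series (fun m => sum_f_R0 (fun j => u j m) J) (sum_f_R0 s J).
Proof.
  intros H. induction J as [|J IH]; simpl; [apply H|].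
  now apply (is_series_plus (fun m => sum_f_R0 (fun j => u j m) J) (u (S J))).
Qed.

Lemma is_series_le_compat (u v : nat -> R) (x y : R) :
  (forall n, u n <= v n) -> is_series u x -> is_series v y -> x <= y.
Proof.
  intros H Hu Hv. apply is_series_sum_f_R0 in Hu. apply is_series_sum_f_R0 in Hv.
  refine (is_lim_seq_le _ _ _ _ _ Hu Hv). intros n. apply sum_Rle. auto.
Qed.

(* The weight of [|a_{j+1}|^2] in Carlson's bound for [|a_{m+1}|]. *)
Definition carlson_weight (A0 : R) (j m : nat) : R :=
  (if Nat.eq_dec m (2 * j + 1) then / (1 + A0) else 0)
  + (if le_dec (2 * j + 2) m then 1 else 0).

Lemma sum_f_R0_shift (f : nat -> R) n :
  sum_f_R0 f (S n) = f 0%nat + sum_f_R0 (fun i => f (S i)) n.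
Proof. induction n as [|n IH]; [reflexivity|]. simpl in *. rewrite IH. ring. Qed.

(** One form for both parities: m even calls [carlson_odd], m odd calls [carlson_even]. The weights
    vanish for m < 2 j + 1, so J may be arbitrary; a J independent of m permits exchanging the sums
    over j and m. *)
Lemma carlson_weighted (a : nat -> C) (F : C -> C) J m :
  disk_conv a -> (forall z, Cmod z < 1 -> has_psum a z (F z)) ->
  (forall z, Cmod z < 1 -> Cmod (F z) <= 1) ->
  Cmod (a (S m)) + sum_f_R0 (fun j => Cmod (a (S j)) ^ 2 * carlson_weight (Cmod (a 0%nat)) j m) J
  <= 1 - Cmod (a 0%nat) ^ 2.
Proof.
  intros Ha HF HF1. set (A0 := Cmod (a 0%nat)).
  assert (HA0 : 0 < / (1 + A0)) by (apply Rinv_0_lt_compat; pose proof (Cmod_ge_0 (a 0%nat)); unfold A0; lra).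
  set (f := fun j => Cmod (a (S j)) ^ 2 * carlson_weight A0 j m).
  assert (Hf : forall j, 0 <= f j).
  { intros j. apply Rmult_le_pos; [apply pow2_ge_0|]. unfold carlson_weight.
    destruct (Nat.eq_dec m (2 * j + 1)), (le_dec (2 * j + 2) m); lra. }
  assert (Hcut : forall n, (forall j, (n < j)%nat -> f j = 0) -> sum_f_R0 f J <= sum_f_R0 f n).
  { intros n Hn. rewrite <- (sum_f_R0_eventually_zero f n (max n J)) by (auto; lia).
    apply sum_f_R0_incr; [exact Hf|lia]. }
  assert (Hone : forall j, (2 * j + 2 <= m)%nat -> f j = Cmod (a (S j)) ^ 2).
  { intros j Hj. unfold f, carlson_weight.
    destruct (Nat.eq_dec m (2 * j + 1)), (le_dec (2 * j + 2) m); try lia. ring. }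
  assert (Hzero : forall j, (m < 2 * j + 1)%nat -> f j = 0).
  { intros j Hj. unfold f, carlson_weight.
    destruct (Nat.eq_dec m (2 * j + 1)), (le_dec (2 * j + 2) m); try lia. ring. }
  destruct (Nat.Even_or_Odd m) as [[n Hn]|[n Hn]].
  - pose proof (carlson_odd a F Ha HF HF1 n) as HC.
    replace (2 * n + 1)%nat with (S m) in HC by lia.
    destruct n as [|n].
    + specialize (Hcut 0%nat ltac:(intros; apply Hzero; lia)). cbn [sum_f_R0] in *.
      rewrite (Hzero 0%nat) in Hcut by lia. fold A0 in HC. lra.
    + specialize (Hcut n ltac:(intros; apply Hzero; lia)).
      rewrite sum_f_R0_shift in HC. fold A0 in HC.
      rewrite (sum_eq f (fun j => Cmod (a (S j)) ^ 2) n) in Hcut by (intros; apply Hone; lia).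
      lra.
  - pose proof (carlson_even a F Ha HF HF1 n) as HC.
    replace (2 * S n)%nat with (S m) in HC by lia.
    specialize (Hcut n ltac:(intros; apply Hzero; lia)).
    assert (Hfn : f n = Cmod (a (S n)) ^ 2 / (1 + A0)).
    { unfold f, carlson_weight.
      destruct (Nat.eq_dec m (2 * n + 1)), (le_dec (2 * n + 2) m); try lia. unfold Rdiv; ring. }
    fold A0 in HC. destruct n as [|n].
    + cbn [sum_f_R0] in *. fold A0 in HC. lra.
    + rewrite sum_f_R0_shift in HC. fold A0 in HC. cbn [sum_f_R0] in Hcut.
      rewrite (sum_eq f (fun j => Cmod (a (S j)) ^ 2) n) in Hcut by (intros; apply Hone; lia).
      lra.
Qed.

(** With y = x^2 and s = p/2 <= 1 this is y^s <= 1 + s (y - 1), the concavity of the power. For y =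
    exp u, take the tangent of exp at s u, evaluate it at u and at 0, and average with weights s and
    1 - s: the linear terms cancel. *)
Lemma rpow_tangent_le (x p : R) : 0 <= x -> 0 < p <= 2 ->
  rpow x p + p / 2 * (1 - x ^ 2) <= 1.
Proof.
  intros Hx Hp. unfold rpow. destruct (Req_EM_T x 0) as [->|Hx0]; [simpl; lra|].
  assert (Hpos : 0 < x) by lra. unfold Rpower.
  set (s := p / 2). set (u := 2 * ln x).
  assert (Hs : 0 < s <= 1) by (unfold s; lra).
  replace (p * ln x) with (s * u) by (unfold s, u; field).
  assert (Eu : x ^ 2 = exp u).
  { unfold u. replace (2 * ln x) with (ln x + ln x) by ring.
    rewrite exp_plus, exp_ln by easy. ring. }
  rewrite Eu. set (v := exp (s * u)). assert (Hv : 0 < v) by apply exp_pos.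
  assert (H1 : v * (1 + (1 - s) * u) <= exp u).
  { replace (exp u) with (v * exp ((1 - s) * u)) by (unfold v; rewrite <- exp_plus; f_equal; ring).
    apply Rmult_le_compat_l; [lra|]. apply exp_ineq1_le. }
  assert (H2 : v * (1 + - (s * u)) <= 1).
  { replace 1 with (v * exp (- (s * u))) at 2
      by (unfold v; rewrite <- exp_plus, Rplus_opp_r; apply exp_0).
    apply Rmult_le_compat_l; [lra|]. apply exp_ineq1_le. }
  assert (s * (v * (1 + (1 - s) * u)) <= s * exp u) by (apply Rmult_le_compat_l; lra).
  assert ((1 - s) * (v * (1 + - (s * u))) <= (1 - s) * 1) by (apply Rmult_le_compat_l; lra).
  lra.
Qed.

Lemma sup_norm_upper (h : C -> C) : sup_norm h = 1 ->
  forall z, Cmod z < 1 -> Cmod (h z) <= 1.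
Proof.
  intros Hsup z Hz. unfold sup_norm in Hsup.
  set (E := fun x => exists z, unit_disk z /\ x = Cmod (h z)) in *.
  destruct (Lub_Rbar_correct E) as [Hub _].
  assert (HE : E (Cmod (h z))) by (exists z; split; [exact Hz|reflexivity]).
  (* [real] sends infinite values to 0, so a supremum of value 1 is finite. *)
  specialize (Hub _ HE). destruct (Lub_Rbar E) as [l| |]; simpl in *; lra.
Qed.

Lemma class_F_ex_series (psi : nat -> R -> R) r :
  class_F psi -> unit_Ico r -> ex_series (fun n => psi n r).
Proof.
  intros (_ & _ & HU) Hr. destruct (HU r Hr) as (d & Hd & HC).
  exists (real (Lim_seq (fun N => sum_n (fun k => psi k r) N))).
  apply is_series_sum_f_R0. apply is_lim_seq_spec. intros eps.
  destruct (HC eps) as [N HN]. exists N. intros n Hn.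
  rewrite <- sum_n_Reals. apply HN; [easy|]. split; [easy|].
  rewrite Rminus_diag, Rabs_R0. exact Hd.
Qed.

Lemma is_series_Psi (psi : nat -> R -> R) t r :
  class_F psi -> unit_Ico r -> is_series (fun k => psi (t + k)%nat r) (Psi psi t r).
Proof.
  intros HF Hr. apply Series_correct. apply (ex_series_incr_n (fun n => psi n r) t).
  now apply class_F_ex_series.
Qed.

(** Summing the weights of |a_{j+1}|^2 over m rebuilds the bracket of [quadratic_term] at j + 1: the
    isolated weight sits at m + 1 = 2 (j + 1), and the unit weights start one index later. *)
Lemma is_series_carlson_weight (psi : nat -> R -> R) A0 r j :
  class_F psi -> unit_Ico r ->
  is_series (fun m => carlson_weight A0 j m * psi (S m) r)
    (psi (2 * S j)%nat r / (1 + A0) + Psi psi (2 * S j + 1) r).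
Proof.
  intros HF Hr. apply is_series_ext with
    (fun m => plus (if Nat.eq_dec m (2 * j + 1) then psi (S m) r / (1 + A0) else 0)
              (if le_dec (2 * j + 2) m then psi (S m) r else 0)).
  - intros m. unfold carlson_weight, Rdiv. change plus with Rplus.
    destruct (Nat.eq_dec m (2 * j + 1)), (le_dec (2 * j + 2) m); lra.
  - apply (is_series_plus (K := R_AbsRing) (V := R_NormedModule)).
    + replace (2 * S j)%nat with (S (2 * j + 1)) by lia.
      exact (is_series_single (fun m => psi (S m) r / (1 + A0)) (2 * j + 1)).
    + apply (is_series_shifted (fun m => psi (S m) r)); [lia|].
      apply is_series_ext with (2 := is_series_Psi psi (2 * S j + 1) r HF Hr).
      intros n. f_equal; lia.
Qed.

Lemma Psi_1_ge0 (psi : nat -> R -> R) r : class_F psi -> unit_Ico r -> 0 <= Psi psi 1 r.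
Proof.
  intros HF Hr. pose proof (is_series_Psi psi 1 r HF Hr) as Hs.
  assert (H : sum_f_R0 (fun k => psi (1 + k)%nat r) 0 <= Psi psi 1 r).
  { apply sum_f_R0_le_is_series; [|exact Hs]. intros; now apply HF. }
  simpl in H. assert (0 <= psi 1%nat r) by now apply HF. lra.
Qed.

Lemma bohr_inequality_holds (K p : R) (psi : nat -> R -> R) (RK : R) :
  1 <= K -> 0 < p <= 2 -> class_F psi -> decreasing_from_1 psi ->
  (forall r, unit_Ico r -> r <= RK -> Phi4 K p psi r <= 0) ->
  bohr_inequality_upto K p psi RK.
Proof.
  intros HK Hp HF Hdec HPhi f h g a b [Hharm [Hsp Hqc]] _ Hsup r Hr HrK.
  destruct Hharm as (_ & _ & Hta & Htb & Hb0 & _).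
  assert (Hpa : forall z, Cmod z < 1 -> has_psum a z (h z))
    by (intros; apply is_pseries_has_psum; now apply Hta).
  assert (Hpb : forall z, Cmod z < 1 -> has_psum b z (g z))
    by (intros; apply is_pseries_has_psum; now apply Htb).
  pose proof (disk_conv_has_psum a h Hpa) as Hda.
  pose proof (disk_conv_has_psum b g Hpb) as Hdb.
  pose proof (sup_norm_upper h Hsup) as Hh1.
  assert (Hder : forall c u z, disk_conv c -> (forall z, Cmod z < 1 -> has_psum c z (u z)) ->
             Cmod z < 1 -> has_psum (dcoef c) z (C_derive u z)).
  { intros c u z Hdc Hu Hz.
    destruct (has_psum_ex (dcoef c) z (disk_conv_dcoef c Hdc) Hz) as [l Hl].
    rewrite (is_C_derive_unique u z l); [exact Hl|].
    now apply (has_psum_is_derive c). }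
  set (k := (K - 1) / (K + 1)).
  assert (Hk : 0 <= k) by (apply Rmult_le_pos; [lra|left; apply Rinv_0_lt_compat; lra]).
  assert (HkK : 2 * K / (K + 1) = 1 + k) by (unfold k; field; lra).
  assert (Hl2 : forall N, sum_f_R0 (fun n => Cmod (dcoef b n) ^ 2) N
                  <= sum_f_R0 (fun n => k ^ 2 * Cmod (dcoef a n) ^ 2) N).
  { intros N.
    rewrite (sum_eq (fun n => k ^ 2 * Cmod (dcoef a n) ^ 2)
               (fun n => Cmod (dcoef a n) ^ 2 * k ^ 2)) by (intros; ring).
    rewrite <- scal_sum.
    apply (dominated_partial_l2 (dcoef a) (dcoef b) (C_derive h) (C_derive g));
      auto using disk_conv_dcoef.
    (* At a zero of h' the Jacobian would be -|g'|^2 <= 0. *)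
    intros z Hz E. specialize (Hsp z Hz). rewrite E, Cmod_0 in Hsp.
    pose proof (pow2_ge_0 (Cmod (C_derive g z))). lra. }
  set (A0 := Cmod (a 0%nat)). set (D := 1 - A0 ^ 2).
  assert (HD : forall J m, Cmod (a (S m))
     + sum_f_R0 (fun j => Cmod (a (S j)) ^ 2 * carlson_weight A0 j m) J <= D).
  { intros. now apply (carlson_weighted a h). }
  assert (Hwpos : forall j m, 0 <= carlson_weight A0 j m).
  { intros j m. assert (0 < / (1 + A0))
      by (apply Rinv_0_lt_compat; pose proof (Cmod_ge_0 (a 0%nat)); unfold A0; lra).
    unfold carlson_weight. destruct (Nat.eq_dec m (2 * j + 1)), (le_dec (2 * j + 2) m); lra. }
  assert (HaD : forall m, Cmod (a (S m)) <= D).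
  { intros m. eapply Rle_trans; [|apply (HD 0%nat m)]. cbn [sum_f_R0].
    pose proof (Rmult_le_pos _ _ (pow2_ge_0 (Cmod (a 1%nat))) (Hwpos 0%nat m)). lra. }
  assert (HD0 : 0 <= D) by (eapply Rle_trans; [apply Cmod_ge_0|apply (HaD 0%nat)]).
  assert (Hpsi : forall n, 0 <= psi n r) by (intros; now apply HF).
  pose proof (Psi_1_ge0 psi r HF Hr) as HPsi0.
  pose proof (is_series_Psi psi 1 r HF Hr) as HPsi. cbn [Nat.add] in HPsi.
  set (P := Psi psi 1 r) in *.
  assert (HPN : forall N, sum_f_R0 (fun n => psi (S n) r) N <= P).
  { intros N. apply sum_f_R0_le_is_series; auto. }
  destruct (ex_series_bounded (fun n => Cmod (b (S n)) * psi (S n) r) (k * D * P)) as [Hbex Hble].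
  { intros n. apply Rmult_le_pos; [apply Cmod_ge_0|easy]. }
  { apply weighted_cauchy_schwarz; auto; [now apply Rmult_le_pos|]. intros N.
    set (w := fun n => psi (S n) r / INR (S n) ^ 2).
    assert (HSn : forall n, 0 < INR (S n)) by (intros; apply lt_0_INR; lia).
    assert (Hid : forall c n, Cmod (dcoef c n) ^ 2 * w n = Cmod (c (S n)) ^ 2 * psi (S n) r).
    { intros c n. unfold dcoef, w. rewrite Cmod_INR_mult. specialize (HSn n). field. lra. }
    rewrite (sum_eq _ (fun n => Cmod (dcoef b n) ^ 2 * w n)) by (intros; now rewrite Hid).
    eapply Rle_trans; [apply (abel_sum_le _ _ w Hl2)|].
    - intros n. apply Rmult_le_pos; [easy|]. left. apply Rinv_0_lt_compat, pow_lt, HSn.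
    - intros n. unfold w, Rdiv. apply Rmult_le_compat; auto.
      + left. apply Rinv_0_lt_compat, pow_lt, HSn.
      + apply Hdec; [lia|easy].
      + apply Rinv_le_contravar; [apply pow_lt, HSn|]. apply pow_incr.
        split; [left; apply HSn|]. apply le_INR; lia.
    (* Carlson's bound for each single coefficient, |a_n| <= D, is inserted only after the squares
       of b have been compared with those of a. *)
    - apply Rle_trans with (sum_f_R0 (fun n => psi (S n) r * (k * D) ^ 2) N).
      + apply sum_Rle. intros n _. rewrite Rmult_assoc, Hid.
        assert (Cmod (a (S n)) ^ 2 <= D ^ 2).
        { apply pow_incr. split; [apply Cmod_ge_0|apply HaD]. }
        specialize (Hpsi (S n)). pose proof (pow2_ge_0 k).
        replace (psi (S n) r * (k * D) ^ 2) with (k ^ 2 * (D ^ 2 * psi (S n) r)) by ring.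
        apply Rmult_le_compat_l; [easy|]. now apply Rmult_le_compat_r.
      + rewrite <- scal_sum. apply Rmult_le_compat_l; [apply pow2_ge_0|apply HPN]. }
  set (al := fun n => Cmod (a (S n)) * psi (S n) r).
  destruct (ex_series_bounded al (D * P)) as [Haex _].
  { intros n. apply Rmult_le_pos; [apply Cmod_ge_0|easy]. }
  { intros N. apply Rle_trans with (sum_f_R0 (fun n => psi (S n) r * D) N).
    - apply sum_Rle. intros n _. unfold al. rewrite Rmult_comm.
      apply Rmult_le_compat_l; [easy|apply HaD].
    - rewrite <- scal_sum. now apply Rmult_le_compat_l. }
  assert (Hqpos : forall n, 0 <= quadratic_term psi a r (S n)).
  { intros n. unfold quadratic_term. fold A0. apply Rmult_le_pos; [apply pow2_ge_0|].
    apply (is_series_le_compat (fun _ => 0) _ 0 _) with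
      (3 := is_series_carlson_weight psi A0 r n HF Hr).
    - intros m. now apply Rmult_le_pos.
    - apply is_series_sum_f_R0. apply is_lim_seq_ext with (fun _ => 0);
        [|apply is_lim_seq_const]. intros m. rewrite sum_cte. ring. }
  destruct (ex_series_bounded (fun n => quadratic_term psi a r (S n)) (D * P - Series al))
    as [Hqex Hqle]; [exact Hqpos| |].
  { intros J.
    (* Only finitely many quadratic terms are expanded at a time, so a finite sum is exchanged with
       a series. The a-part and these terms then share the single budget D psi_{m+1} at each m. *)
    assert (Hq : is_series (fun m => sum_f_R0 (fun j =>
         Cmod (a (S j)) ^ 2 * (carlson_weight A0 j m * psi (S m) r)) J)
         (sum_f_R0 (fun j => quadratic_term psi a r (S j)) J)).
    { apply (is_series_finite_sum (fun j m => Cmod (a (S j)) ^ 2 * (carlson_weight A0 j m * psi (S m) r))).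
      intros j. apply (@is_series_scal R_AbsRing R_NormedModule (Cmod (a (S j)) ^ 2) _ _).
      now apply is_series_carlson_weight. }
    pose proof (is_series_plus _ _ _ _ (Series_correct _ Haex) Hq) as Hs.
    pose proof (@is_series_scal R_AbsRing R_NormedModule D _ _ HPsi) as HsD.
    assert (Hle : Series al + sum_f_R0 (fun j => quadratic_term psi a r (S j)) J <= D * P); [|lra].
    refine (is_series_le_compat _ _ _ _ _ Hs HsD). intros m.
    change (al m + sum_f_R0 (fun j => Cmod (a (S j)) ^ 2 * (carlson_weight A0 j m * psi (S m) r)) J
            <= D * psi (S m) r).
    rewrite (sum_eq _ (fun j => Cmod (a (S j)) ^ 2 * carlson_weight A0 j m * psi (S m) r))
      by (intros; ring).
    rewrite <- scal_sum. unfold al. specialize (HD J m). specialize (Hpsi (S m)). nra. }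
  assert (Hlin : is_series (fun n => linear_term psi a b r (S n))
            (Series al + Series (fun n => Cmod (b (S n)) * psi (S n) r))).
  { apply is_series_ext with (fun n => plus (al n) (Cmod (b (S n)) * psi (S n) r)).
    - intros n. change (@eq R (Cmod (a (S n)) * psi (S n) r + Cmod (b (S n)) * psi (S n) r)
                         ((Cmod (a (S n)) + Cmod (b (S n))) * psi (S n) r)). ring.
    - apply (is_series_plus (K := R_AbsRing) (V := R_NormedModule)); now apply Series_correct. }
  split; [now exists (Series al + Series (fun n => Cmod (b (S n)) * psi (S n) r))|].
  split; [exact Hqex|]. rewrite (is_series_unique _ _ Hlin), Hsup.
  fold A0. pose proof (rpow_tangent_le A0 p (Cmod_ge_0 _) Hp) as Ht. fold D in Ht.
  specialize (HPhi r Hr HrK). unfold Phi4 in HPhi. fold P in HPhi. rewrite HkK in HPhi.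
  specialize (Hpsi 0%nat).
  (* The a-part, the b-part and the quadratic part cost at most D (1 + k) P together. The sign of
     Phi_4 converts this into (p/2) D psi_0, and the tangent inequality leaves exactly that much
     room next to |a_0|^p psi_0. *)
  assert (H1 : D * ((1 + k) * P) <= D * (p / 2 * psi 0%nat r)) by (apply Rmult_le_compat_l; lra).
  assert (H2 : (rpow A0 p + p / 2 * D) * psi 0%nat r <= 1 * psi 0%nat r)
    by (apply Rmult_le_compat_r; lra).
  lra.
Qed.

(** * Sharpness *)

Section Extremal.
Variable (x : R).
Hypothesis (Hx : 0 < x < 1).

Definition blaschke (z : C) : C := ((x - z) / (1 - x * z))%C.
Definition blaschke_coef (n : nat) : C :=
  match n with O => RtoC x | S m => (- ((1 - x ^ 2) * x ^ m))%R end.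

Lemma blaschke_denom_lower z : Cmod z < 1 -> 1 - x <= Cmod (1 - x * z)%C.
Proof.
  intros Hz. assert (H : Cmod 1 <= Cmod (1 - x * z)%C + Cmod (x * z)%C).
  { replace (RtoC 1) with (1 - x * z + x * z)%C at 1 by ring. apply Cmod_triangle. }
  rewrite Cmod_1, Cmod_mult, Cmod_R, Rabs_pos_eq in H by lra.
  pose proof (Cmod_ge_0 z). nra.
Qed.

Lemma blaschke_denom_neq_0 z : Cmod z < 1 -> (1 - x * z)%C <> 0%C.
Proof.
  intros Hz. apply Cmod_gt_0. pose proof (blaschke_denom_lower z Hz). lra.
Qed.

Lemma blaschke_partial_sum z n : Cmod z < 1 ->
  (csum (fun i => blaschke_coef i * z ^ i) n - blaschke z)%C
  = ((1 - x ^ 2) * z / (1 - x * z) * (x * z) ^ n)%C.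
Proof.
  intros Hz. pose proof (blaschke_denom_neq_0 z Hz) as Hd.
  unfold blaschke. induction n as [|n IH].
  - simpl. field. exact Hd.
  - cbn [csum].
    transitivity ((csum (fun i => blaschke_coef i * z ^ i) n - (x - z) / (1 - x * z))
       + blaschke_coef (S n) * z ^ S n)%C; [ring|].
    rewrite IH. unfold blaschke_coef.
    rewrite RtoC_opp, RtoC_mult, RtoC_minus, !RtoC_pow, !Cpow_mult_l, !Cpow_S. field. exact Hd.
Qed.

Lemma has_psum_blaschke z : Cmod z < 1 -> has_psum blaschke_coef z (blaschke z).
Proof.
  intros Hz. unfold has_psum.
  apply is_lim_seq_ext with
    (fun n => Cmod ((1 - x ^ 2) * z / (1 - x * z))%C * Cmod (x * z)%C ^ n).
  { intros n. now rewrite blaschke_partial_sum, (Cmod_mult _ ((x * z) ^ n)%C), Cmod_pow. }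
  rewrite <- (Rmult_0_r (Cmod ((1 - x ^ 2) * z / (1 - x * z))%C)).
  apply is_lim_seq_mult'; [apply is_lim_seq_const|]. apply is_lim_seq_geom.
  rewrite Rabs_pos_eq by apply Cmod_ge_0.
  rewrite Cmod_mult, Cmod_R, Rabs_pos_eq by lra. pose proof (Cmod_ge_0 z). nra.
Qed.

Definition blaschke_deriv (z : C) : C := (- ((1 - x ^ 2) / ((1 - x * z) * (1 - x * z))))%C.

(** The parameters cover both parts of the extremal mapping: c = 1, d = 0 for h and c = k, d = x for
    g. The second-order remainder is the explicit rational function q (w - z)^2 / (1 - x w). *)
Lemma is_derive_blaschke (c d z : C) : Cmod z < 1 ->
  @is_derive C_AbsRing C_NormedModule (fun w => c * (blaschke w - d))%C z
    (c * blaschke_deriv z)%C.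
Proof.
  intros Hz. pose proof (blaschke_denom_neq_0 z Hz) as Hdz.
  set (q := (c * (- ((1 - x ^ 2) * x)) / ((1 - x * z) * (1 - x * z)))%C).
  apply (is_C_derive_quadratic _ z _ (Cmod q / (1 - x)) (1 - Cmod z)); [lra|].
  intros w Hw. assert (Hw1 : Cmod w < 1).
  { replace w with (w - z + z)%C by ring. eapply Rle_lt_trans; [apply Cmod_triangle|lra]. }
  pose proof (blaschke_denom_neq_0 w Hw1) as Hdw.
  replace (c * (blaschke w - d) - c * (blaschke z - d) - (w - z) * (c * blaschke_deriv z))%C
    with (q * (w - z) ^ 2 / (1 - x * w))%C
    by (unfold q, blaschke, blaschke_deriv; simpl; field; auto).
  rewrite Cmod_div, Cmod_mult, Cmod_pow by exact Hdw.
  pose proof (blaschke_denom_lower w Hw1). unfold Rdiv.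
  replace (Cmod q * / (1 - x) * Cmod (w - z) ^ 2)
    with (Cmod q * Cmod (w - z) ^ 2 * / (1 - x)) by ring.
  apply Rmult_le_compat_l.
  - apply Rmult_le_pos; [apply Cmod_ge_0|apply pow2_ge_0].
  - apply Rinv_le_contravar; lra.
Qed.

Lemma C_derive_blaschke z : Cmod z < 1 -> C_derive blaschke z = blaschke_deriv z.
Proof.
  intros Hz. apply is_C_derive_unique.
  apply is_derive_ext with (fun w => 1 * (blaschke w - 0))%C.
  { intros w. change ((1 * (blaschke w - 0))%C = blaschke w). ring. }
  rewrite <- (Cmult_1_l (blaschke_deriv z)). now apply is_derive_blaschke.
Qed.

Lemma blaschke_deriv_neq_0 z : Cmod z < 1 -> blaschke_deriv z <> 0%C.
Proof.
  intros Hz E. pose proof (blaschke_denom_neq_0 z Hz) as Hd.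
  assert (H : RtoC (1 - x ^ 2) = 0%C).
  { transitivity (- blaschke_deriv z * ((1 - x * z) * (1 - x * z)))%C.
    - unfold blaschke_deriv. rewrite RtoC_minus, RtoC_pow. field. exact Hd.
    - rewrite E. ring. }
  apply RtoC_inj in H. nra.
Qed.

Lemma Cmod_blaschke_le z : Cmod z < 1 -> Cmod (blaschke z) <= 1.
Proof.
  intros Hz. pose proof (blaschke_denom_neq_0 z Hz) as Hd.
  unfold blaschke. rewrite Cmod_div by exact Hd.
  assert (Hp : 0 < Cmod (1 - x * z)%C) by now apply Cmod_gt_0.
  apply (Rmult_le_reg_r (Cmod (1 - x * z)%C)); [easy|].
  unfold Rdiv. rewrite Rmult_assoc, Rinv_l, Rmult_1_r, Rmult_1_l by lra.
  apply Rsqr_incr_0_var; [|lra]. rewrite !Rsqr_pow2.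
  assert (Hz2 : Cmod z ^ 2 <= 1).
  { rewrite <- (pow1 2). apply pow_incr. split; [apply Cmod_ge_0|lra]. }
  rewrite Cmod2_alt in Hz2. rewrite !Cmod2_alt. destruct z as [u v]. simpl in *.
  (* This product is |1 - x z|^2 - |x - z|^2. *)
  assert (0 <= (1 - x * x) * (1 - (u * u + v * v))) by (apply Rmult_le_pos; nra). lra.
Qed.

Lemma blaschke_bounded : bounded_on_disk blaschke.
Proof. exists 1. exact Cmod_blaschke_le. Qed.

Lemma sup_norm_blaschke : sup_norm blaschke = 1.
Proof.
  unfold sup_norm. rewrite (is_lub_Rbar_unique _ (Finite 1)); [reflexivity|]. split.
  - intros y (z & Hz & ->). now apply Cmod_blaschke_le.
  - intros b Hb.
    (* The supremum is approached along the negative axis: at z = -t the value is (x + t) / (1 + x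
       t) >= t. *)
    assert (Ht : forall t, 0 <= t < 1 -> Rbar_le t b).
    { intros t Ht. assert (Hzt : Cmod (RtoC (- t)) < 1)
        by (rewrite Cmod_R, Rabs_Ropp, Rabs_pos_eq; lra).
      eapply Rbar_le_trans; [|apply Hb; exists (RtoC (- t)); split; [exact Hzt|reflexivity]].
      replace (blaschke (- t)%R) with (RtoC ((x + t) / (1 + x * t))).
      2:{ unfold blaschke. rewrite RtoC_div by nra.
          f_equal; rewrite ?RtoC_plus, ?RtoC_mult, ?RtoC_opp; ring. }
      simpl. rewrite Cmod_R. eapply Rle_trans; [|apply Rle_abs].
      assert (Hd : 0 < 1 + x * t) by nra.
      apply (Rmult_le_reg_r (1 + x * t)); [easy|].
      unfold Rdiv. rewrite Rmult_assoc, Rinv_l by lra.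
      assert (0 <= x * (1 - t * t)) by (apply Rmult_le_pos; nra). lra. }
    destruct b as [b| |]; simpl; [|easy|exact (Ht 0 ltac:(lra))].
    apply Rnot_lt_le. intros Hb1.
    pose proof (Ht 0 ltac:(lra)) as H0. simpl in H0.
    pose proof (Ht ((1 + b) / 2) ltac:(lra)) as H2. simpl in H2. lra.
Qed.

Variable (k : R).
Hypothesis (Hk : 0 <= k < 1).

(** Subtracting x gives b_0 = 0; the dilatation is then constantly k, the largest value allowed. *)
Definition coblaschke (z : C) : C := (k * (blaschke z - x))%C.

Definition coblaschke_coef (n : nat) : C :=
  match n with O => 0%C | S m => (k * blaschke_coef (S m))%C end.

Lemma has_psum_coblaschke z : Cmod z < 1 -> has_psum coblaschke_coef z (coblaschke z).
Proof.
  intros Hz. pose proof (has_psum_blaschke z Hz) as H.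
  apply is_lim_seq_ext with
    (fun n => k * Cmod (csum (fun i => blaschke_coef i * z ^ i)%C n - blaschke z)%C).
  - intros n.
    assert (E : csum (fun i => coblaschke_coef i * z ^ i)%C n
                = (k * (csum (fun i => blaschke_coef i * z ^ i) n - x))%C).
    { destruct n as [|n]; [simpl; ring|]. rewrite !csum_shift.
      rewrite (csum_ext (fun i => coblaschke_coef (S i) * z ^ S i)%C
                 (fun i => k * (blaschke_coef (S i) * z ^ S i))%C)
        by (intros; unfold coblaschke_coef; ring).
      rewrite csum_mult_l. simpl. ring. }
    rewrite E. unfold coblaschke.
    rewrite <- (Rabs_pos_eq k) at 1 by lra. rewrite <- Cmod_R, <- Cmod_mult.
    f_equal. ring.
  - rewrite <- (Rmult_0_r k). apply is_lim_seq_mult'; [apply is_lim_seq_const|exact H].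
Qed.

Lemma C_derive_coblaschke z : Cmod z < 1 -> C_derive coblaschke z = (k * blaschke_deriv z)%C.
Proof. intros Hz. apply is_C_derive_unique. now apply is_derive_blaschke. Qed.

Lemma blaschke_sp_qc_harmonic_mapping K : (K - 1) / (K + 1) = k ->
  sp_qc_harmonic_mapping K (fun z => blaschke z + Cconj (coblaschke z))%C
    blaschke coblaschke blaschke_coef coblaschke_coef.
Proof.
  intros HK. split; [|split].
  - split; [|split; [|split; [|split; [|split]]]].
    + intros z Hz. exists (1 * blaschke_deriv z)%C.
      apply is_derive_ext with (fun w => 1 * (blaschke w - 0))%C.
      { intros w. change ((1 * (blaschke w - 0))%C = blaschke w). ring. }
      now apply is_derive_blaschke.
    + intros z Hz. exists (k * blaschke_deriv z)%C. now apply is_derive_blaschke.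
    + intros z Hz. apply is_pseries_has_psum. now apply has_psum_blaschke.
    + intros z Hz. apply is_pseries_has_psum. now apply has_psum_coblaschke.
    + reflexivity.
    + reflexivity.
  - intros z Hz. rewrite C_derive_blaschke, C_derive_coblaschke by exact Hz.
    rewrite Cmod_mult, Cmod_R, Rabs_pos_eq by lra.
    assert (0 < Cmod (blaschke_deriv z)) by now apply Cmod_gt_0, blaschke_deriv_neq_0.
    set (m := Cmod (blaschke_deriv z)) in *.
    replace (m ^ 2 - (k * m) ^ 2) with (m * m * (1 - k * k)) by ring.
    apply Rmult_lt_0_compat; nra.
  - intros z Hz. rewrite C_derive_blaschke, C_derive_coblaschke, HK by exact Hz.
    pose proof (blaschke_deriv_neq_0 z Hz) as Hnz.
    replace (k * blaschke_deriv z / blaschke_deriv z)%C with (RtoC k) by (field; exact Hnz).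
    rewrite Cmod_R, Rabs_pos_eq; lra.
Qed.
End Extremal.

(** * First-order comparison as the extremal parameter tends to 1 *)

Lemma one_minus_rpow_le (x p : R) : 0 < x < 1 -> 0 < p -> x * (1 - rpow x p) <= p * (1 - x).
Proof.
  intros Hx Hp. unfold rpow. destruct (Req_EM_T x 0); [lra|]. unfold Rpower.
  (* The chain is 1 - x^p <= -p ln x <= p (1/x - 1); the factor x in the statement clears the
     denominator and is harmless near x = 1. *)
  pose proof (exp_ineq1_le (p * ln x)) as H1.
  pose proof (exp_ineq1_le (- ln x)) as H2. rewrite exp_Ropp, exp_ln in H2 by lra.
  assert (Hinv : x * / x = 1) by (apply Rinv_r; lra).
  assert (H3 : x * (1 + - ln x) <= 1) by (rewrite <- Hinv; apply Rmult_le_compat_l; lra).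
  assert (H4 : x * (1 - exp (p * ln x)) <= x * - (p * ln x)) by (apply Rmult_le_compat_l; lra).
  assert (p * (x * (1 + - ln x)) <= p * 1) by (apply Rmult_le_compat_l; lra).
  lra.
Qed.

Lemma bernoulli_le (x : R) n : 0 <= x <= 1 -> 1 - INR n * (1 - x) <= x ^ n.
Proof.
  intros Hx. induction n as [|n IH]; [simpl; lra|]. rewrite S_INR. simpl.
  assert (0 <= INR n * (1 - x)) by (apply Rmult_le_pos; [apply pos_INR|lra]).
  assert (x * (1 - INR n * (1 - x)) <= x * x ^ n) by (apply Rmult_le_compat_l; lra).
  nra.
Qed.

Lemma bohr_radius_sharp (K p : R) (psi : nat -> R -> R) (R' r : R) :
  1 <= K -> 0 < p <= 2 -> class_F psi -> unit_Ico r -> r <= R' ->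
  0 < Phi4 K p psi r -> ~ bohr_inequality_upto K p psi R'.
Proof.
  intros HK Hp HF Hr HrR HPhi HB.
  set (k := (K - 1) / (K + 1)).
  assert (Hk : 0 <= k < 1).
  { split; [apply Rmult_le_pos; [lra|left; apply Rinv_0_lt_compat; lra]|].
    apply (Rmult_lt_reg_r (K + 1)); [lra|]. unfold k, Rdiv.
    rewrite Rmult_assoc, Rinv_l by lra. lra. }
  assert (HkK : 2 * K / (K + 1) = 1 + k) by (unfold k; field; lra).
  unfold Phi4 in HPhi. rewrite HkK in HPhi.
  pose proof (is_series_Psi psi 1 r HF Hr) as HPsi. cbn [Nat.add] in HPsi.
  set (P := Psi psi 1 r) in *. set (psi0 := psi 0%nat r) in *.
  assert (Hpsi : forall n, 0 <= psi n r) by (intros; now apply HF).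
  assert (Hpsi0 : 0 <= psi0) by apply Hpsi.
  (* The strict inequality Phi_4 > 0 survives truncation of Psi_1. With N fixed, x^N can be brought
     close to 1, so no limit has to be taken under an infinite sum. *)
  assert (HN : exists N, p * psi0 < 2 * ((1 + k) * sum_f_R0 (fun n => psi (S n) r) N)).
  { apply is_series_sum_f_R0 in HPsi. apply is_lim_seq_spec in HPsi.
    set (e := P - p / 2 * psi0 / (1 + k)).
    assert (He : 0 < e).
    { apply (Rmult_lt_reg_l (1 + k)); [lra|]. unfold e.
      replace ((1 + k) * (P - p / 2 * psi0 / (1 + k))) with ((1 + k) * P - p / 2 * psi0)
        by (field; lra). lra. }
    destruct (HPsi (mkposreal e He)) as [N HN]. exists N.
    specialize (HN N (le_n N)). apply Rabs_lt_between in HN. simpl in HN.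
    assert (H1 : p / 2 * psi0 / (1 + k) < sum_f_R0 (fun n => psi (S n) r) N) by (unfold e in HN; lra).
    apply (Rmult_lt_compat_l (1 + k)) in H1; [|lra].
    replace ((1 + k) * (p / 2 * psi0 / (1 + k))) with (p / 2 * psi0) in H1 by (field; lra).
    lra. }
  destruct HN as [N HN].
  set (S0 := sum_f_R0 (fun n => psi (S n) r) N) in *. set (T := (1 + k) * S0) in *.
  assert (HS0 : 0 <= S0) by (apply cond_pos_sum; intros; apply Hpsi).
  assert (HT : 0 < T).
  { assert (0 <= p * psi0) by (apply Rmult_le_pos; lra). lra. }
  (* The inequality for the extremal mapping, with the non-negative quadratic part dropped and a
     factor 1 - x cancelled. Of the exponent N + 1, N comes from x^n >= x^N for n <= N and 1 from
     the factor x in [one_minus_rpow_le]. Letting x tend to 1 would give 2 T <= p psi_0, against the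
     choice of N. *)
  assert (Hkey : forall x, 0 < x < 1 -> T * (1 + x) * x ^ S N <= p * psi0).
  { intros x Hx.
    destruct (HB _ _ _ _ _ (blaschke_sp_qc_harmonic_mapping x Hx k Hk K eq_refl)
                (blaschke_bounded x Hx) (sup_norm_blaschke x Hx) r Hr HrR)
      as (Hlin & Hquad & Hineq).
    rewrite (sup_norm_blaschke x Hx), Rmult_1_r in Hineq. fold psi0 in Hineq.
    simpl (blaschke_coef x 0) in Hineq. rewrite Cmod_R, (Rabs_pos_eq x) in Hineq by lra.
    assert (Hq0 : 0 <= Series (fun n => quadratic_term psi (blaschke_coef x) r (S n))).
    { apply (is_series_le_compat (fun _ => 0) (fun n => quadratic_term psi (blaschke_coef x) r (S n)) 0 _).
      - intros n. apply Rmult_le_pos; [apply pow2_ge_0|]. apply Rplus_le_le_0_compat.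
        + apply Rmult_le_pos; [easy|]. left. apply Rinv_0_lt_compat.
          pose proof (Cmod_ge_0 (blaschke_coef x 0)). lra.
        + apply (is_series_le_compat (fun _ => 0) _ 0 _) with
            (3 := is_series_Psi psi (2 * S n + 1) r HF Hr); [intros; apply Hpsi|].
          apply is_series_sum_f_R0. apply is_lim_seq_ext with (fun _ => 0);
            [|apply is_lim_seq_const]. intros m. rewrite sum_cte. ring.
      - apply is_series_sum_f_R0. apply is_lim_seq_ext with (fun _ => 0);
          [|apply is_lim_seq_const]. intros m. rewrite sum_cte. ring.
      - now apply Series_correct. }
    assert (Hx2 : 0 <= 1 - x ^ 2) by nra.
    assert (Hxn : forall n, 0 <= x ^ n) by (intros; apply pow_le; lra).
    assert (Hterm : forall n, linear_term psi (blaschke_coef x) (coblaschke_coef x k) r (S n)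
               = (1 + k) * (1 - x ^ 2) * x ^ n * psi (S n) r).
    { intros n. unfold linear_term, coblaschke_coef, blaschke_coef.
      rewrite Cmod_mult, !Cmod_R, Rabs_Ropp, (Rabs_pos_eq k) by lra.
      rewrite Rabs_pos_eq by (apply Rmult_le_pos; auto). ring. }
    assert (Hl : (1 + k) * (1 - x ^ 2) * x ^ N * S0
       <= Series (fun n => linear_term psi (blaschke_coef x) (coblaschke_coef x k) r (S n))).
    { eapply Rle_trans; [|apply (sum_f_R0_le_is_series
         (fun n => linear_term psi (blaschke_coef x) (coblaschke_coef x k) r (S n)) N)].
      - unfold S0. rewrite scal_sum. apply sum_Rle. intros n Hn. rewrite Hterm.
        rewrite (Rmult_comm (psi (S n) r)). apply Rmult_le_compat_r; [easy|].
        apply Rmult_le_compat_l; [apply Rmult_le_pos; lra|].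
        replace N with (n + (N - n))%nat by lia. rewrite pow_add.
        rewrite <- (Rmult_1_r (x ^ n)) at 2. apply Rmult_le_compat_l; [easy|].
        rewrite <- (pow1 (N - n)). apply pow_incr; lra.
      - intros n. rewrite Hterm. repeat apply Rmult_le_pos; auto; lra.
      - now apply Series_correct. }
    pose proof (one_minus_rpow_le x p Hx (proj1 Hp)) as Hrp.
    assert (Ha : (1 + k) * (1 - x ^ 2) * x ^ N * S0 <= (1 - rpow x p) * psi0) by lra.
    apply (Rmult_le_reg_l (1 - x)); [lra|].
    apply Rle_trans with (x * ((1 - rpow x p) * psi0)).
    - apply Rle_trans with (x * ((1 + k) * (1 - x ^ 2) * x ^ N * S0)).
      + unfold T. simpl pow. apply Req_le. ring.
      + apply Rmult_le_compat_l; lra.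
    - assert (x * (1 - rpow x p) * psi0 <= p * (1 - x) * psi0) by (apply Rmult_le_compat_r; lra).
      lra. }
  set (M := INR (S N)). assert (HM : 0 <= M) by apply pos_INR.
  (* The limit made explicit with x = 1 - y: T (2 - y) (1 - M y) >= 2 T - T (1 + 2 M) y, and y is
     chosen so that this loss is at most half of the gap 2 T - p psi_0. *)
  set (y := Rmin (/ 2) ((2 * T - p * psi0) / (2 * (T * (1 + 2 * M))))).
  assert (HTM : 0 < 2 * (T * (1 + 2 * M))) by nra.
  assert (Hy0 : 0 < y).
  { apply Rmin_glb_lt; [lra|]. apply Rdiv_lt_0_compat; lra. }
  assert (Hy1 : y <= / 2) by apply Rmin_l.
  assert (Hy2 : y * (2 * (T * (1 + 2 * M))) <= 2 * T - p * psi0).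
  { pose proof (Rmin_r (/ 2) ((2 * T - p * psi0) / (2 * (T * (1 + 2 * M))))) as H. fold y in H.
    apply (Rmult_le_compat_r (2 * (T * (1 + 2 * M)))) in H; [|lra].
    unfold Rdiv in H. rewrite Rmult_assoc, Rinv_l in H by lra. lra. }
  specialize (Hkey (1 - y) ltac:(lra)).
  pose proof (bernoulli_le (1 - y) (S N) ltac:(lra)) as Hb. fold M in Hb.
  replace (1 - (1 - y)) with y in Hb by ring.
  assert (T * (1 + (1 - y)) * (1 - M * y) <= p * psi0).
  { eapply Rle_trans; [|exact Hkey]. apply Rmult_le_compat_l; [nra|exact Hb]. }
  assert (0 <= T * (M * y * y)) by (repeat apply Rmult_le_pos; lra).
  assert (T * (1 + 2 * M) * y < 2 * (T * (1 + 2 * M)) * y) by nra.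
  nra.
Qed.

Theorem corollary4p1 (K p : R) (psi : nat -> R -> R) (RK : R) :
  1 <= K ->
  0 < p <= 2 ->
  class_F psi ->
  decreasing_from_1 psi ->
  minimal_positive_root (Phi4 K p psi) RK ->
  (forall r, unit_Ico r -> r <= RK -> Phi4 K p psi r <= 0) ->
  bohr_inequality_upto K p psi RK /\
  ((exists eps, 0 < eps /\
      forall r, unit_Ico r -> RK < r < RK + eps -> 0 < Phi4 K p psi r) ->
   forall R', RK < R' -> ~ bohr_inequality_upto K p psi R').
Proof.
  intros HK Hp HF Hdec [[HR0 HR1] _] HPhi. split.
  - now apply bohr_inequality_holds.
  - intros (eps & Heps & Hpos) R' HR'.
    (* The midpoint of RK and m lies in the interval where Phi_4 > 0 and below R'; the bound 1 keeps
       it in [0,1) even when R' is large. *)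
    set (m := Rmin (RK + eps) (Rmin R' 1)).
    assert (Hm : RK < m) by (repeat apply Rmin_glb_lt; lra).
    assert (Hm1 : m <= RK + eps) by apply Rmin_l.
    assert (Hm2 : m <= R') by (eapply Rle_trans; [apply Rmin_r|apply Rmin_l]).
    assert (Hm3 : m <= 1) by (eapply Rle_trans; [apply Rmin_r|apply Rmin_r]).
    assert (Hr : unit_Ico ((RK + m) / 2)) by (split; lra).
    apply (bohr_radius_sharp K p psi R' ((RK + m) / 2)); auto; [lra|].
    apply Hpos; [exact Hr|lra].
Qed.
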